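(* Let $p$ be a prime, $\alpha>0$, $\gamma>0$, $\gamma<\min(1,\alpha)$, $u_0\in\mathbb{R}$, and let $f:p^{\mathbb{Z}}\times\mathbb{R}\to\mathbb{R}$. Suppose that: (i) there is a constant $M$ with $|f(p^{\ell},x)|\le M$ for all $\ell\in\mathbb{Z}$, $x\in\mathbb{R}$; (ii) $|f(p^{\ell},x)-f(p^{\ell},y)|\le F_{\ell}|x-y|$ for all $x,y\in\mathbb{R}$, $\ell\in\mathbb{Z}$, where $0<F_{\ell}<p^{-\alpha\ell}$ for all $\ell\in\mathbb{Z}$; (iii) there are constants $A>0$ and $\beta\in\mathbb{R}$ with $\beta+\gamma>\alpha$ such that $|f(p^{\ell},x)|\le Ap^{-\beta\ell}$ for all $\ell\ge1$ and $x\in\mathbb{R}$. Let $u=u(|t|_p)$, $t\in\mathbb{Q}_p$, be a solution of the integral equation $$u(|t|_p)=u_0+I^{\alpha}\left[|\cdot|_p^{-\gamma}f(|\cdot|_p,u(|\cdot|_p))\right](|t|_p),\qquad t\in\mathbb{Q}_p,$$ obtained by the iteration process with subsequent continuation (described in the context). Then $(D^\alpha u)(|t|_p)$ exists for all $0\ne t\in\mathbb{Q}_p$ and $u$ satisfies $$|t|_p^{\gamma}(D^{\alpha}u)(|t|_p)=f(|t|_p,u(|t|_p)),\qquad 0\ne t\in\mathbb{Q}_p.$$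
   Context: $\mathbb{Q}_p$ is the field of $p$-adic numbers with norm $|\cdot|_p$; $p^{\mathbb{Z}}=\{p^k:k\in\mathbb{Z}\}$; $dy$ is Haar measure on $\mathbb{Q}_p$ normalized so that the unit ball has measure $1$. A radial function is a function of $|t|_p$ only; all solutions are radial and real-valued. The Vladimirov operator is $$(D^{\alpha}\varphi)(t)=\frac{1-p^{\alpha}}{1-p^{-\alpha-1}}\int_{\mathbb{Q}_p}|y|_p^{-\alpha-1}[\varphi(t-y)-\varphi(t)]\,dy ,$$ and it is said to exist at $t$ when this integral converges absolutely. The $p$-adic fractional integral is $$(I^{\alpha}\varphi)(x)=\frac{1-p^{-\alpha}}{1-p^{\alpha-1}}\int_{|y|_p\le|x|_p}\big(|x-y|_p^{\alpha-1}-|y|_p^{\alpha-1}\big)\varphi(y)\,dy\quad(\alpha\ne1),$$ $$(I^{1}\varphi)(x)=\frac{1-p}{p\log p}\int_{|y|_p\le|x|_p}\big(\log|x-y|_p-\log|y|_p\big)\varphi(y)\,dy,$$ whenever the integral converges absolutely (value $0$ at $x=0$). Write $\widetilde f(|t|_p,x)=|t|_p^{-\gamma}f(|t|_p,x)$ for $t\ne0$. ''Obtained by the iteration process with subsequent continuation'' means: for some $N\in\mathbb{Z}$, on the ball $|t|_p\le p^N$ the function $u$ is a solution of the integral equation which is the uniform limit of the iterates $u_k(|t|_p)=u_0+I^{\alpha}[\widetilde f(|\cdot|_p,u_{k-1}(|\cdot|_p))](|t|_p)$, $k\ge1$, started from the constant function $u_0$; and for each $\ell\ge N$ the value $u(p^{\ell+1})$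 is a solution of $$u(p^{\ell+1})=u_0+v_0^{(\ell)}+p^{\alpha\ell}\,\widetilde f(p^{\ell+1},u(p^{\ell+1})),$$ where $v_0^{(\ell)}=\frac{1-p^{-\alpha}}{1-p^{\alpha-1}}\int_{|y|_p\le p^{\ell}}\big(p^{(\ell+1)(\alpha-1)}-|y|_p^{\alpha-1}\big)\widetilde f(|y|_p,u(|y|_p))\,dy$ if $\alpha\ne1$, and $v_0^{(\ell)}=\frac{1-p}{p\log p}\int_{|y|_p\le p^{\ell}}\big(\log p^{\ell+1}-\log|y|_p\big)\widetilde f(|y|_p,u(|y|_p))\,dy$ if $\alpha=1$ (this is the integral equation at $|t|_p=p^{\ell+1}$). *)

(* Defs.v *)
From HB Require Import structures.
From mathcomp Require Import all_boot all_order all_algebra.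
From mathcomp Require Import all_classical all_reals all_analysis.

Set Implicit Arguments.
Unset Strict Implicit.
Unset Printing Implicit Defensive.

Import Order.TTheory GRing.Theory Num.Theory.
Import numFieldNormedType.Exports.

Local Open Scope classical_set_scope.
Local Open Scope ring_scope.

(* Z_p is the inverse limit of the rings Z / p^n: a p-adic integer is its
   sequence of least non-negative residues modulo p^n.  The compatibility
   condition already forces 0 <= a n < p^n. *)
Record padic_int (p : nat) (p_prime : prime p) := PadicInt {
  residue :> nat -> int;
  residueP : forall n, residue n = (residue n.+1 %% (p ^ n)%N%:Z)%Z }.

Arguments PadicInt {p} p_prime residue residueP.

Section PadicIntegers.
Variables (p : nat) (p_prime : prime p).
Local Notation Zp := (padic_int p_prime).
Implicit Types (a b c : Zp) (s : nat -> int).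

HB.instance Definition _ := gen_eqMixin Zp.
HB.instance Definition _ := gen_choiceMixin Zp.

Let pn n : int := (p ^ n)%N%:Z.

Let pn_gt0 n : 0 < pn n.
Proof. by rewrite /pn ltz_nat expn_gt0 prime_gt0. Qed.

Let pn_dvd m n : (m <= n)%N -> (pn m %| pn n)%Z.
Proof. by move=> mn; rewrite /pn dvdzE /= dvdn_exp2l. Qed.

Let modpn m n (x : int) : (m <= n)%N -> ((x %% pn n)%Z = x %[mod pn m])%Z.
Proof.
move=> /pn_dvd/dvdzP[k kE]; rewrite {2}(divz_eq x (pn n)) {3}kE mulrA.
by rewrite modzMDl.
Qed.

Lemma residue_le a m n : (m <= n)%N -> a m = (a n %% pn m)%Z.
Proof.
elim: n => [|n IH]; first by rewrite leqn0 => /eqP ->; rewrite residueP modz_mod.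
rewrite leq_eqVlt => /orP[/eqP ->|]; first by rewrite [in LHS]residueP;
  rewrite (residueP a n.+1) modz_mod.
by rewrite ltnS => mn; rewrite (IH mn) (residueP a n) modpn.
Qed.

Lemma residue_mod a n : (a n %% pn n)%Z = a n.
Proof. by rewrite -residue_le. Qed.

Lemma padic_intP a b : (forall n, a n = b n) -> a = b.
Proof.
case: a b => [a Pa] [b Pb] /= /funext ab; rewrite -{b}ab in Pb *.
by congr PadicInt; exact: Prop_irrelevance.
Qed.

Definition coherent s := forall n, (s n = s n.+1 %[mod pn n])%Z.

Lemma reduceP s (sP : coherent s) n :
  (s n %% pn n)%Z = ((s n.+1 %% pn n.+1)%Z %% pn n)%Z.
Proof. by rewrite modpn //; exact: sP. Qed.

Definition reduce s (sP : coherent s) : Zp :=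
  PadicInt p_prime (fun n => (s n %% pn n)%Z) (reduceP sP).

Lemma coherent_residue a n : (a n = a n.+1 %[mod pn n])%Z.
Proof. by rewrite residue_mod [in LHS]residueP. Qed.

Lemma coherentD a b : coherent (fun n => a n + b n).
Proof.
by move=> n; rewrite -modzDm coherent_residue (coherent_residue b) modzDm.
Qed.

Lemma coherentN a : coherent (fun n => - a n).
Proof. by move=> n; rewrite -modzNm coherent_residue modzNm. Qed.

Lemma coherentM a b : coherent (fun n => a n * b n).
Proof.
by move=> n; rewrite -modzMm coherent_residue (coherent_residue b) modzMm.
Qed.

Lemma coherent_cst (z : int) : coherent (fun=> z).
Proof. by []. Qed.

Definition padic_int_add a b := reduce (coherentD a b).
Definition padic_int_opp a := reduce (coherentN a).
Definition padic_int_mul a b := reduce (coherentM a b).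
Definition padic_int_cst z := reduce (coherent_cst z).

Let addA : associative padic_int_add.
Proof. by move=> a b c; apply: padic_intP => n /=; rewrite modzDml modzDmr addrA. Qed.
Let addC : commutative padic_int_add.
Proof. by move=> a b; apply: padic_intP => n /=; rewrite addrC. Qed.
Let add0 : left_id (padic_int_cst 0) padic_int_add.
Proof. by move=> a; apply: padic_intP => n /=; rewrite modzDml add0r residue_mod. Qed.
Let addN : left_inverse (padic_int_cst 0) padic_int_opp padic_int_add.
Proof. by move=> a; apply: padic_intP => n /=; rewrite modzDml addNr. Qed.

HB.instance Definition _ := GRing.isZmodule.Build Zp addA addC add0 addN.

Let mulA : associative padic_int_mul.
Proof. by move=> a b c; apply: padic_intP => n /=; rewrite modzMml modzMmr mulrA. Qed.
Let mulC : commutative padic_int_mul.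
Proof. by move=> a b; apply: padic_intP => n /=; rewrite mulrC. Qed.
Let mul1 : left_id (padic_int_cst 1) padic_int_mul.
Proof. by move=> a; apply: padic_intP => n /=; rewrite modzMml mul1r residue_mod. Qed.
Let mulD : left_distributive padic_int_mul padic_int_add.
Proof.
by move=> a b c; apply: padic_intP => n /=; rewrite modzMml modzDm mulrDl.
Qed.
Let one_neq0 : padic_int_cst 1 != 0 :> Zp.
Proof.
apply/eqP => /(congr1 (fun a : Zp => a 1%N)) /=.
by rewrite /pn expn1 mod0z modz_small // ltz_nat prime_gt1.
Qed.

HB.instance Definition _ :=
  GRing.Zmodule_isComNzRing.Build Zp mulA mulC mul1 mulD one_neq0.

Lemma padic_int0E n : (0 : Zp) n = 0. Proof. exact: mod0z. Qed.
Lemma padic_int1E n : (1 : Zp) n = (1 %% pn n)%Z. Proof. by []. Qed.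
Lemma padic_intDE a b n : (a + b) n = ((a n + b n) %% pn n)%Z. Proof. by []. Qed.
Lemma padic_intNE a n : (- a) n = ((- a n) %% pn n)%Z. Proof. by []. Qed.
Lemma padic_intME a b n : (a * b) n = ((a n * b n) %% pn n)%Z. Proof. by []. Qed.

Definition padic_int_unit : pred Zp := fun a => `[< exists b, b * a = 1 >].
Definition padic_int_inv a : Zp :=
  if pselect (exists b, b * a = 1) is left ab then projT1 (cid ab) else a.

Let mulV : {in padic_int_unit, left_inverse 1 padic_int_inv *%R}.
Proof.
by move=> a /asboolP aU; rewrite /padic_int_inv; case: pselect => // ?; case: cid.
Qed.
Let unitP a b : b * a = 1 -> padic_int_unit a.
Proof. by move=> ab; apply/asboolP; exists b. Qed.
Let invr_out : {in [predC padic_int_unit], padic_int_inv =1 id}.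
Proof.
by move=> a /asboolP aU; rewrite /padic_int_inv; case: pselect.
Qed.

HB.instance Definition _ :=
  GRing.ComNzRing_hasMulInverse.Build Zp mulV unitP invr_out.

Lemma padic_int_neq0P a : a != 0 -> exists n, a n.+1 != 0.
Proof.
move=> a0; apply: contrapT => aE; move/eqP: a0; apply; apply: padic_intP => n.
rewrite padic_int0E; apply/eqP; apply: contrapT => /negP an0.
apply: aE; exists n; apply: contra an0 => /eqP aS.
by rewrite residueP aS mod0z.
Qed.

(* The p-adic valuation of a non-zero p-adic integer: the least n such that a
   is non-zero modulo p^(n+1); the value at 0 is irrelevant. *)
Definition padic_int_val a : nat :=
  if pselect (exists n, a n.+1 != 0) is left h then ex_minn h else 0.

Lemma padic_int_valP a : a != 0 ->
  exists2 z, a (padic_int_val a).+1 = z * pn (padic_int_val a)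
  & ~~ (p%:Z %| z)%Z.
Proof.
move=> /padic_int_neq0P a0; rewrite /padic_int_val; case: pselect => // h.
case: ex_minnP => n an0 nmin.
have an : a n = 0.
  case: n {an0} nmin => [_|n nmin].
    by rewrite residueP expn0 modz1.
  by apply/eqP; apply: contraT => /nmin; rewrite ltnn.
have : (pn n %| a n.+1)%Z by apply/dvdz_mod0P; rewrite -residueP.
case/dvdzP => z az; exists z => //; apply: contra an0 => /dvdzP[y zE].
rewrite -residue_mod az zE -mulrA /pn expnS PoszM.
by rewrite modzMl.
Qed.

Lemma padic_int_val_unique a n z :
  a n.+1 = z * pn n -> ~~ (p%:Z %| z)%Z -> a != 0 /\ padic_int_val a = n.
Proof.
move=> az pz.
have an0 : a n.+1 != 0.
  rewrite az mulf_neq0 ?(gt_eqF (pn_gt0 n))//; apply/eqP => z0.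
  by rewrite z0 dvdz0 in pz.
have ak k : (k < n)%N -> a k.+1 = 0.
  move=> kn; rewrite (residue_le a (leqW kn)) az.
  by apply/dvdz_mod0P; rewrite dvdz_mull// pn_dvd.
split; first by apply: contra an0 => /eqP ->; rewrite padic_int0E.
rewrite /padic_int_val; case: pselect => [h|[]]; last by exists n.
case: ex_minnP => m am0 mmin; apply/eqP; rewrite eqn_leq mmin//=.
by rewrite leqNgt; apply: contra am0 => /ak ->.
Qed.

Lemma padic_int_val_ge a n : a != 0 -> (n <= padic_int_val a)%N = (a n == 0).
Proof.
move=> /padic_int_valP[z aE pz]; apply/idP/eqP => [nv|an0].
  rewrite (residue_le a (leqW nv)) aE.
  by apply/dvdz_mod0P; rewrite dvdz_mull// pn_dvd.
rewrite leqNgt; apply/negP => vn.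
have := residue_le a vn; rewrite an0 mod0z aE => /eqP; rewrite mulf_eq0.
by rewrite (gt_eqF (pn_gt0 _)) orbF => /eqP z0; rewrite z0 dvdz0 in pz.
Qed.

Lemma padic_int_valM a b : a != 0 -> b != 0 ->
  a * b != 0 /\ padic_int_val (a * b) = (padic_int_val a + padic_int_val b)%N.
Proof.
move=> /padic_int_valP[za aE pa] /padic_int_valP[zb bE pb].
move: (padic_int_val a) (padic_int_val b) aE bE => m n aE bE.
have lift c k l z : c k.+1 = z * pn k -> ~~ (p%:Z %| z)%Z ->
    exists2 y, c (k + l).+1 = y * pn k & ~~ (p%:Z %| y)%Z.
  move=> cE pz; set q := (c (k + l).+1 %/ pn k.+1)%Z.
  exists (q * p%:Z + z).
    rewrite mulrDl -cE (@residue_le c k.+1 (k + l).+1) ?ltnS ?leq_addr//.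
    by rewrite -mulrA /pn -PoszM -expnS; exact: divz_eq.
  by rewrite rpredDl ?dvdz_mull.
have [y aE' py] := lift a m n za aE pa.
have [w bE' pw] := lift b n m zb bE pb.
pose q := (y * w * pn (m + n) %/ pn (m + n).+1)%Z.
apply: (@padic_int_val_unique (a * b) (m + n) (y * w - q * p%:Z)).
  rewrite padic_intME aE' [X in b X.+1]addnC bE' /modz.
  have -> : y * pn m * (w * pn n) = y * w * pn (m + n).
    by rewrite mulrACA /pn -PoszM -expnD.
  by rewrite -/q mulrBl /pn expnS PoszM mulrA.
have pyw : ~~ (p%:Z %| y * w)%Z.
  by rewrite dvdzE abszM Euclid_dvdM// negb_or; apply/andP.
by rewrite rpredBr; [exact: pyw | exact: dvdz_mull].
Qed.

Variable R : realFieldType.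

Definition padic_int_norm a : R :=
  if a == 0 then 0 else p%:R ^- padic_int_val a.

Lemma padic_int_norm_eq0 a : (padic_int_norm a == 0) = (a == 0).
Proof.
rewrite /padic_int_norm; have [_|_] := eqVneq a 0; first exact: eqxx.
by rewrite gt_eqF// invr_gt0 exprn_gt0// ltr0n prime_gt0.
Qed.

Lemma padic_int_normM a b :
  padic_int_norm (a * b) = padic_int_norm a * padic_int_norm b.
Proof.
rewrite /padic_int_norm.
have [->|a0] := eqVneq a 0; first by rewrite !mul0r eqxx.
have [->|b0] := eqVneq b 0; first by rewrite !mulr0 eqxx.
have [/negPf -> ->] := padic_int_valM a0 b0.
by rewrite exprD invfM.
Qed.

Lemma padic_int_normD a b :
  padic_int_norm (a + b) <= Num.max (padic_int_norm a) (padic_int_norm b).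
Proof.
have ler_exp m n : (m <= n)%N -> p%:R ^- n <= p%:R ^- m :> R.
  move=> mn; rewrite lef_pV2 ?posrE ?exprn_gt0 ?ltr0n ?prime_gt0//.
  by rewrite ler_weXn2l// ler1n prime_gt0.
have [->|a0] := eqVneq a 0; first by rewrite add0r le_max lexx orbT.
have [->|b0] := eqVneq b 0; first by rewrite addr0 le_max lexx.
rewrite /padic_int_norm (negPf a0) (negPf b0).
case: eqVneq => [_|ab0].
  by rewrite le_max invr_ge0 exprn_ge0// ler0n.
rewrite le_max; have [ab|/ltnW ba] := leqP (padic_int_val a) (padic_int_val b).
  rewrite ler_exp// padic_int_val_ge// padic_intDE.
  have := ab; rewrite (padic_int_val_ge _ b0) => /eqP ->; rewrite addr0.
  by have := leqnn (padic_int_val a); rewrite padic_int_val_ge// residue_mod.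
rewrite orbC ler_exp// padic_int_val_ge// padic_intDE.
have := ba; rewrite (padic_int_val_ge _ a0) => /eqP ->; rewrite add0r.
by have := leqnn (padic_int_val b); rewrite padic_int_val_ge// residue_mod.
Qed.

Lemma padic_int_norm_ge0 a : 0 <= padic_int_norm a.
Proof.
by rewrite /padic_int_norm; case: ifP => // _; rewrite invr_ge0 exprn_ge0.
Qed.

Lemma padic_int_normN a : padic_int_norm (- a) = padic_int_norm a.
Proof.
have le b : padic_int_norm (- b) <= padic_int_norm b.
  rewrite /padic_int_norm oppr_eq0; case: eqVneq => // b0.
  rewrite lef_pV2 ?posrE ?exprn_gt0 ?ltr0n ?prime_gt0//.
  rewrite ler_weXn2l ?ler1n ?prime_gt0// padic_int_val_ge ?oppr_eq0//.
  have := leqnn (padic_int_val b); rewrite padic_int_val_ge// padic_intNE.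
  by move=> /eqP ->; rewrite oppr0 mod0z.
by apply/le_anti; rewrite le -{1}[a]opprK le.
Qed.

Lemma padic_int_natE k n : (k%:R : Zp) n = (k%:Z %% pn n)%Z.
Proof.
elim: k => [|k IH]; first by rewrite padic_int0E mod0z.
by rewrite mulrS padic_intDE IH padic_int1E modzDm -PoszD.
Qed.

Lemma padic_int_norm1 : padic_int_norm 1 = 1.
Proof.
have N0 : padic_int_norm 1 != 0 by rewrite padic_int_norm_eq0 oner_neq0.
by apply: (mulfI N0); rewrite mulr1 -padic_int_normM mulr1.
Qed.

Lemma padic_int_norm_prime : padic_int_norm p%:R = p%:R^-1.
Proof.
have [|//|p0 pv] := @padic_int_val_unique p%:R 1 1.
- rewrite padic_int_natE mul1r modz_small ?expn1// ltz_nat /=.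
  by rewrite -{1}[p]expn1 ltn_exp2l ?prime_gt1.
- by rewrite dvdzE /= dvdn1 gtn_eqF ?prime_gt1.
- by rewrite /padic_int_norm (negPf p0) pv expr1.
Qed.

End PadicIntegers.
Arguments padic_int_norm {p p_prime} R a.

Lemma padic_int_integral p (p_prime : prime p) :
  GRing.integral_domain_axiom (padic_int p_prime).
Proof.
move=> a b /eqP ab0; apply: contraT; rewrite negb_or => /andP[a0 b0].
by have [] := padic_int_valM a0 b0; rewrite ab0.
Qed.

HB.instance Definition _ p (p_prime : prime p) :=
  GRing.ComUnitRing_isIntegral.Build (padic_int p_prime)
    (@padic_int_integral p p_prime).

Definition padic p (p_prime : prime p) : Type := {fraction padic_int p_prime}.

HB.instance Definition _ p (p_prime : prime p) :=
  GRing.Field.on (padic p_prime).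
HB.instance Definition _ p (p_prime : prime p) :=
  isPointed.Build (padic p_prime) 0.

Section PadicNumbers.
Variables (p : nat) (p_prime : prime p).
Local Notation Zp := (padic_int p_prime).
Local Notation Qp := (padic p_prime).
Implicit Types (x y : Qp) (a b : Zp).

Definition padic_of_int (a : Zp) : Qp := FracField.tofrac a.

Definition padic_norm (R : realFieldType) x : R :=
  let q := frac (repr (x : {fraction Zp})) in
  padic_int_norm R q.1 / padic_int_norm R q.2.

(* The norm is real-valued when R is the field of reals; the rational-valued
   instance makes the topology independent of the choice of R. *)
Definition padic_open (U : set Qp) := forall x, U x ->
  exists2 e : rat, 0 < e & forall y, padic_norm rat (y - x) < e -> U y.

(* the Borel sigma-algebra *)
HB.instance Definition _ := @isMeasurable.Build (sigma_display padic_open) Qp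
  <<s padic_open >> (@sigma_algebra0 _ setT padic_open)
  (@sigma_algebraC _ padic_open) (@sigma_algebra_bigcup _ setT padic_open).

Lemma padic_fracE x :
  let q := frac (repr (x : {fraction Zp})) in
  x = padic_of_int q.1 / padic_of_int q.2.
Proof.
move=> q; have q0 : q.2 != 0 by exact: denom_ratioP.
apply: (@mulIf _ (padic_of_int q.2)); first by rewrite tofrac_eq0.
rewrite divfK ?tofrac_eq0//.
rewrite -[x in LHS](@reprK _ ({fraction Zp})) /padic_of_int.
unlock FracField.tofrac; rewrite -[LHS]FracField.pi_mul.
apply/eqmodP; rewrite /= FracField.equivfE /FracField.mulf.
by rewrite !numden_Ratio ?mulr1 ?oner_eq0// mulrC.
Qed.

Lemma padic_norm_frac (R : realFieldType) a b : b != 0 ->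
  padic_norm R (padic_of_int a / padic_of_int b) =
  padic_int_norm R a / padic_int_norm R b.
Proof.
move=> b0; have := padic_fracE (padic_of_int a / padic_of_int b).
rewrite /padic_norm; set q := frac _ => /= /eqP.
have q0 : q.2 != 0 by exact: denom_ratioP.
rewrite eqr_div ?tofrac_eq0// -!tofracM tofrac_eq => /eqP abq.
by apply/eqP; rewrite eqr_div ?padic_int_norm_eq0// -!padic_int_normM abq.
Qed.

Section Norm.
Variable R : realFieldType.

Lemma padic_norm0 : padic_norm R (0 : Qp) = 0.
Proof.
have := padic_norm_frac R 0 (oner_neq0 Zp); rewrite /padic_of_int tofrac0 mul0r.
by move=> ->; rewrite {1}/padic_int_norm eqxx mul0r.
Qed.

Lemma padic_norm_eq0 x : (padic_norm R x == 0) = (x == 0).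
Proof.
apply/eqP/eqP => [|->]; last exact: padic_norm0.
rewrite /padic_norm => /eqP; rewrite mulf_eq0 invr_eq0 !padic_int_norm_eq0.
rewrite (negPf (denom_ratioP _)) orbF => /eqP x0.
by rewrite [x]padic_fracE x0 /padic_of_int tofrac0 mul0r.
Qed.

Lemma padic_norm_ge0 x : 0 <= padic_norm R x.
Proof. by rewrite divr_ge0 ?padic_int_norm_ge0. Qed.

Lemma padic_normM x y : padic_norm R (x * y) = padic_norm R x * padic_norm R y.
Proof.
rewrite {1}[x]padic_fracE {1}[y]padic_fracE mulf_div /padic_of_int -!tofracM.
rewrite padic_norm_frac ?mulf_neq0 ?denom_ratioP//.
by rewrite !padic_int_normM -mulf_div.
Qed.

Lemma padic_normN x : padic_norm R (- x) = padic_norm R x.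
Proof.
rewrite {1}[x]padic_fracE -mulNr /padic_of_int -tofracN.
by rewrite padic_norm_frac ?denom_ratioP// padic_int_normN.
Qed.

Lemma padic_normD x y :
  padic_norm R (x + y) <= Num.max (padic_norm R x) (padic_norm R y).
Proof.
rewrite {1}[x]padic_fracE {1}[y]padic_fracE {2 3}/padic_norm.
move: (frac (repr (x : {fraction Zp}))) (denom_ratioP (repr (x : {fraction Zp}))).
move: (frac (repr (y : {fraction Zp}))) (denom_ratioP (repr (y : {fraction Zp}))).
move=> [c d] /= d0 [a b] /= b0.
rewrite addf_div ?tofrac_eq0// -!tofracM -tofracD padic_norm_frac ?mulf_neq0//.
rewrite ler_pdivrMr ?lt_def ?padic_int_norm_eq0 ?padic_int_norm_ge0 ?mulf_neq0//.
rewrite maxr_pMl ?padic_int_norm_ge0// !padic_int_normM.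
rewrite mulrA divfK ?padic_int_norm_eq0// [X in Num.max _ X]mulrCA divfK ?padic_int_norm_eq0//.
by rewrite -!padic_int_normM [b * c]mulrC padic_int_normD.
Qed.

Lemma padic_norm_prime : padic_norm R (p%:R : Qp) = p%:R^-1.
Proof.
have := padic_norm_frac R p%:R (oner_neq0 Zp).
rewrite /padic_of_int rmorph_nat tofrac1 divr1 => ->.
by rewrite padic_int_norm_prime padic_int_norm1 divr1.
Qed.

End Norm.

End PadicNumbers.
Arguments padic_norm {p p_prime} R x.

Section Operators.
Variables (R : realType) (p : nat) (p_prime : prime p).
Local Notation Qp := (padic p_prime).
Local Notation "`| x |_p" := (padic_norm R x)
  (at level 0, x at level 99, format "`| x |_p").
Local Notation q := (p%:R : R).
Implicit Types (t x y : Qp) (phi : Qp -> R) (f : R -> R -> R) (u : R -> R).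

(* The Haar measure of the additive group of Q_p for which the unit ball has
   measure 1; these properties determine it uniquely. *)
Definition normalized_haar (mu : {measure set Qp -> \bar R}) :=
  (forall x (A : set Qp), measurable A -> mu [set x + y | y in A] = mu A) /\
  mu [set y | `|y|_p <= 1] = 1%E.

Variable mu : {measure set Qp -> \bar R}.

Definition vladimirov_integrand (alpha : R) phi t y : R :=
  `|y|_p `^ (- alpha - 1) * (phi (t - y) - phi t).

Definition vladimirov_exists alpha phi t :=
  mu.-integrable setT (EFin \o vladimirov_integrand alpha phi t).

Definition vladimirov alpha phi t : R :=
  (1 - q `^ alpha) / (1 - q `^ (- alpha - 1)) *
  \int[mu]_y vladimirov_integrand alpha phi t y.

Definition fracint_const (alpha : R) : R :=
  if alpha == 1 then (1 - q) / (q * ln q)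
  else (1 - q `^ (- alpha)) / (1 - q `^ (alpha - 1)).

Definition fracint_kernel (alpha r s : R) : R :=
  if alpha == 1 then ln r - ln s else r `^ (alpha - 1) - s `^ (alpha - 1).

Definition fracint_integrand alpha phi x y : R :=
  fracint_kernel alpha `|x - y|_p `|y|_p * phi y.

Definition fracint_exists alpha phi x :=
  x = 0 \/ mu.-integrable [set y | `|y|_p <= `|x|_p]
             (EFin \o fracint_integrand alpha phi x).

Definition fracint alpha phi x : R :=
  if x == 0 then 0 else
  fracint_const alpha *
  \int[mu]_(y in [set y | `|y|_p <= `|x|_p]) fracint_integrand alpha phi x y.

(* Only the values at r in p^Z matter: at r = 0, powR makes this 0. *)
Definition ftilde (gamma : R) f (r x : R) : R := r `^ (- gamma) * f r x.

Definition solves_integral_eq alpha gamma f (u0 : R) u t :=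
  let phi y := ftilde gamma f `|y|_p (u `|y|_p) in
  fracint_exists alpha phi t /\ u `|t|_p = u0 + fracint alpha phi t.

Fixpoint iterate alpha gamma f (u0 : R) (k : nat) : Qp -> R :=
  if k is k'.+1 then
    fun t => u0 + fracint alpha
      (fun y => ftilde gamma f `|y|_p (iterate alpha gamma f u0 k' y)) t
  else fun=> u0.

(* the iterates are given by absolutely convergent integrals on the ball D *)
Definition iterates_exist alpha gamma f (u0 : R) (D : set Qp) :=
  forall k t, D t -> fracint_exists alpha
    (fun y => ftilde gamma f `|y|_p (iterate alpha gamma f u0 k y)) t.

Definition v0_integrand alpha gamma f u (l : int) y : R :=
  fracint_kernel alpha (q ^ (l + 1)) `|y|_p * ftilde gamma f `|y|_p (u `|y|_p).

Definition v0_exists alpha gamma f u (l : int) :=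
  mu.-integrable [set y | `|y|_p <= q ^ l]
    (EFin \o v0_integrand alpha gamma f u l).

Definition v0 alpha gamma f u (l : int) : R :=
  fracint_const alpha *
  \int[mu]_(y in [set y | `|y|_p <= q ^ l]) v0_integrand alpha gamma f u l y.

Definition obtained_by_iteration alpha gamma f (u0 : R) u :=
  exists N : int, let D := [set t | `|t|_p <= q ^ N] in
  [/\ forall t, D t -> solves_integral_eq alpha gamma f u0 u t,
      iterates_exist alpha gamma f u0 D,
      {uniform D, iterate alpha gamma f u0 @ \oo --> (fun t => u `|t|_p)} &
      forall l : int, N <= l -> v0_exists alpha gamma f u l /\
        u (q ^ (l + 1)) = u0 + v0 alpha gamma f u l +
          q `^ (alpha * l%:~R) * ftilde gamma f (q ^ (l + 1)) (u (q ^ (l + 1)))].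

End Operators.

(* Main.v *)
Require Import Defs.
From mathcomp Require Import all_boot all_order all_algebra.
From mathcomp Require Import all_classical all_reals all_analysis.
From mathcomp Require Import measurable_realfun ring lra zify.

(** On radial functions the integral operator [I^alpha] and the operator
    [D^alpha] are both given by series over the powers of [p], and there they
    are inverse to each other up to constants.  Put [q = p], [a = q^alpha],
    [r = 1/a], let [psi_j] be the value of [|.|^(-gamma) f(|.|, u(|.|))] on the
    sphere [|y| = q^j] and [w_j = u(q^j)].

    The kernel of [I^alpha], multiplied by the constant in front of the
    integral, is [L_n - L_j] for [|x - y| = q^n] and [|y| = q^j], where
    [L_(j+1) - L_j = - (1 - r) (a/q)^j] for every [alpha > 0]: the logarithmic
    case [alpha = 1] obeys the same recursion, so it needs no separate
    treatment.  For [|x| = q^n] the integrand is non-zero only on two balls of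
    radius [q^(n-1)], one around [0] and one around [x], and is constant on the
    spheres around either centre.  Hence
      [w_n = u0 + (1 - 1/q) sum_(j<n) (L_n - L_j) q^j (psi_j - psi_n)],
    and, with [S_n = sum_(j<n) q^j psi_j],
      [w_(n+1) - w_n = - (1 - 1/q) (1 - r) (a/q)^n S_(n+1)
                       + a^n psi_(n+1) - r a^n psi_n].

    In the same way, for [|t| = q^n] the integrand of [D^alpha u] lives on a
    ball around [t] and on [|y| > q^n], which gives the two series
      [(aq)^(-n) sum_(j<n) q^j (w_j - w_n)] and [sum_(j>n) r^j (w_j - w_n)].
    By the recursion for [w] both of them telescope ([sum_lower],
    [sum_upper]), the terms containing [S] cancel, and what remains is a
    multiple of [psi_n] that the constant in front of [D^alpha] turns into
    [psi_n] ([radial_inversion]).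

    The growth condition that makes all this converge is
    [|psi_j| <= M q^(-gamma j)].  It decays as [j] grows since [gamma > 0], and
    it is weaker than the weights [q^j] and [a^j] as [j] decreases since
    [gamma < min(1, alpha)].  Each series that occurs either has
    a geometric bound or satisfies [X_(k+1) = rho X_k + Y_k] with
    [0 <= rho < 1] and [Y] absolutely summable, and then it is absolutely
    summable as well ([abscvg_rec]).

    Passing from integrals to series requires the Haar measure of balls, which
    follows from translation invariance: a ball of radius [q^(n+1)] is the
    disjoint union of [p] translates of a ball of radius [q^n]. *)

Set Implicit Arguments.
Unset Strict Implicit.
Unset Printing Implicit Defensive.

Import Order.TTheory GRing.Theory Num.Theory.
Import numFieldNormedType.Exports.

Local Open Scope classical_set_scope.
Local Open Scope ring_scope.

(** * Absolutely convergent series indexed by the integers *)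

(** A sum over the integers below or above [n] is read as an ordinary series
    that starts at [n]. *)
Definition descending (T : Type) (n : int) (g : int -> T) (k : nat) : T := g (n - k%:Z).
Definition ascending (T : Type) (n : int) (g : int -> T) (k : nat) : T := g (n + k%:Z).

Lemma descending0 (T : Type) n (g : int -> T) : descending n g 0 = g n.
Proof. by rewrite /descending subr0. Qed.

Lemma ascending0 (T : Type) n (g : int -> T) : ascending n g 0 = g n.
Proof. by rewrite /ascending addr0. Qed.

Lemma descendingS (T : Type) n (g : int -> T) k : descending n g k.+1 = descending (n - 1) g k.
Proof. by rewrite /descending; congr g; lia. Qed.

Lemma descending_shift (T : Type) n (g : int -> T) :
  descending (n - 1) (fun j => g (j + 1)) = descending n g.
Proof. by apply/funext => k; rewrite /descending; congr g; lia. Qed.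

Lemma ascending_shift (T : Type) n (g : int -> T) :
  ascending n (fun j => g (j + 1)) = ascending (n + 1) g.
Proof. by apply/funext => k; rewrite /ascending; congr g; lia. Qed.

Lemma ascendingS (T : Type) n (g : int -> T) k :
  ascending n g k.+1 = ascending n (fun j => g (j + 1)) k.
Proof. by rewrite /ascending; congr g; lia. Qed.

Section Series.
Variable R : realType.
Implicit Types (x y : nat -> R) (rho : R).

Definition abscvg x := cvgn (series (fun k => `|x k|)).

Lemma abscvg_cvg x : abscvg x -> cvgn (series x).
Proof. exact: normed_cvg. Qed.

Lemma abscvg_cvg0 x : abscvg x -> x @ \oo --> 0.
Proof. by move/abscvg_cvg/cvg_series_cvg_0. Qed.

Lemma abscvg_le x y : (forall k, `|x k| <= y k) -> cvgn (series y) -> abscvg x.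
Proof.
move=> xy; apply: series_le_cvg => // k; exact: le_trans (xy k).
Qed.

Lemma abscvg_geometric x (c z : R) : 0 <= z < 1 ->
  (forall k, `|x k| <= c * z ^+ k) -> abscvg x.
Proof.
move=> /andP[z0 z1] xz; apply: (abscvg_le xz).
by apply: is_cvg_geometric_series; rewrite ger0_norm.
Qed.

Lemma abscvg_recl x : abscvg (fun k => x k.+1) -> abscvg x.
Proof.
move=> h; apply/cvg_ex; move/cvg_ex: h => [l hl].
exists (`|x 0| + l); rewrite -cvg_shiftS.
have -> : [sequence (series (fun k => `|x k|)) n.+1]_n =
   (fun n => `|x 0| + series (fun k => `|x k.+1|) n).
  by apply/funext => n; rewrite /series /= big_nat_recl.
by apply: cvgD => //; exact: cvg_cst.
Qed.

Lemma abscvgD x y : abscvg x -> abscvg y -> abscvg (fun k => x k + y k).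
Proof.
move=> cx cy.
apply: (@abscvg_le _ (fun k => `|x k| + `|y k|)) => [k|]; first exact: ler_normD.
exact: is_cvg_seriesD cx cy.
Qed.

Lemma abscvgZ (c : R) x : abscvg x -> abscvg (fun k => c * x k).
Proof.
move=> cx; apply: (@abscvg_le _ (`|c| *: (fun k => `|x k|))).
  by move=> k; rewrite normrM.
exact: is_cvg_seriesZ.
Qed.

(** By induction on [n], [(1 - rho) sum_(k<n) |x_k| + |x_n|] is at most
    [|x_0| + sum_(k<n) |y_k|], so the partial sums are bounded. *)
Lemma abscvg_rec x y rho : 0 <= rho < 1 -> abscvg y ->
  (forall k, `|x k.+1| <= rho * `|x k| + `|y k|) -> abscvg x.
Proof.
move=> /andP[rho0 rho1] cy xy.
have le n : (1 - rho) * series (fun k => `|x k|) n + `|x n| <=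
    `|x 0| + series (fun k => `|y k|) n.
  elim: n => [|n IH]; first by rewrite /series /= !big_geq// mulr0 addr0 add0r.
  rewrite /series /= !big_nat_recr//=; have := xy n; move: IH; rewrite /series /=.
  lra.
apply: nondecreasing_is_cvgn.
  exact: nondecreasing_series.
exists ((`|x 0| + limn (series (fun k => `|y k|))) / (1 - rho)).
move=> _ [n _ <-]; rewrite ler_pdivlMr; last by lra.
have := le n; have : series (fun k => `|y k|) n <= limn (series (fun k => `|y k|)).
  by apply: nondecreasing_cvgn_le => //; exact: nondecreasing_series.
have := normr_ge0 (x n); lra.
Qed.

Lemma cvg_telescope x y : (forall k, x k = y k - y k.+1) -> y @ \oo --> 0 ->
  series x @ \oo --> y 0.
Proof.
move=> xy y0.
have -> : series x = (fun n => y 0 - y n).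
  apply/funext => n; elim: n => [|n IH].
    by rewrite /series /= big_geq// subrr.
  rewrite /series /= big_nat_recr//=; move: IH; rewrite /series /= => ->.
  rewrite xy; lra.
rewrite -{2}[y 0]subr0; apply: cvgB => //; exact: cvg_cst.
Qed.

Lemma lim_series_recl x : cvgn (series (fun k => x k.+1)) ->
  limn (series x) = x 0 + limn (series (fun k => x k.+1)).
Proof.
move=> cx; apply/cvg_lim => //.
rewrite -cvg_shiftS.
have -> : [sequence (series x) n.+1]_n =
   (fun n => x 0 + series (fun k => x k.+1) n).
  by apply/funext => n; rewrite /series /= big_nat_recl.
by apply: cvgD => //; exact: cvg_cst.
Qed.

End Series.

Section IntPower.
Variables (R : realType) (c : R).
Hypothesis c_neq0 : c != 0.

Lemma exprz_addn1 (j : int) : c ^ (j + 1) = c ^ j * c.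
Proof. by rewrite expfzDr// expr1z. Qed.

Lemma exprz_sub1 (j : int) : c ^ (j - 1) = c ^ j / c.
Proof. by rewrite expfzDr. Qed.

Lemma exprz_subn (n : int) (k : nat) : c ^ (n - k%:Z) = c ^ n * c^-1 ^+ k.
Proof. by rewrite expfzDr// -exprnN exprVn. Qed.

End IntPower.

Section IntSeries.
Variable R : realType.
Implicit Types (X Y : int -> R) (c rho : R) (n : int).

Lemma abscvg_descendingD n X Y : abscvg (descending n X) ->
  abscvg (descending n Y) -> abscvg (descending n (fun j => X j + Y j)).
Proof. exact: abscvgD. Qed.

Lemma abscvg_descendingZ n c X : abscvg (descending n X) ->
  abscvg (descending n (fun j => c * X j)).
Proof. exact: abscvgZ. Qed.

Lemma abscvg_ascendingD n X Y : abscvg (ascending n X) ->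
  abscvg (ascending n Y) -> abscvg (ascending n (fun j => X j + Y j)).
Proof. exact: abscvgD. Qed.

Lemma abscvg_ascendingZ n c X : abscvg (ascending n X) ->
  abscvg (ascending n (fun j => c * X j)).
Proof. exact: abscvgZ. Qed.

Lemma abscvg_descending_rec X Y rho n : 0 <= rho < 1 -> abscvg (descending (n - 1) Y) ->
  (forall j, X j = rho * X (j + 1) + Y j) -> abscvg (descending n X).
Proof.
move=> rho01 cY XY; apply: (abscvg_rec rho01 cY) => k.
have /andP[rho0 _] := rho01.
rewrite -[X in X * _ + _](ger0_norm rho0) -normrM descendingS /descending XY.
by rewrite (_ : n - 1 - k%:Z + 1 = n - k%:Z); [exact: ler_normD | lia].
Qed.

Lemma abscvg_ascending_rec X Y rho n : 0 <= rho < 1 -> abscvg (ascending n Y) ->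
  (forall j, X (j + 1) = rho * X j + Y j) -> abscvg (ascending n X).
Proof.
move=> rho01 cY XY; apply: (abscvg_rec rho01 cY) => k.
have /andP[rho0 _] := rho01.
rewrite -[X in X * _ + _](ger0_norm rho0) -normrM /ascending.
rewrite (_ : n + k.+1%:Z = n + k%:Z + 1); last by lia.
by rewrite XY; exact: ler_normD.
Qed.

Lemma abscvg_descending_exprz X (M c : R) n : 1 < c ->
  (forall j, `|X j| <= M * c ^ j) -> abscvg (descending n X).
Proof.
move=> c1 XM; have c0 : c != 0 by apply/eqP => c0; lra.
apply: (@abscvg_geometric _ _ (M * c ^ n) c^-1) => [|k].
  rewrite invr_ge0 (le_trans _ (ltW c1))//= invf_lt1//; lra.
by rewrite /descending (le_trans (XM _))// exprz_subn// mulrA.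
Qed.

Lemma abscvg_ascending_exprz X (M c : R) n : 0 < c < 1 ->
  (forall j, `|X j| <= M * c ^ j) -> abscvg (ascending n X).
Proof.
move=> /andP[c0 c1] XM.
apply: (@abscvg_geometric _ _ (M * c ^ n) c) => [|k]; first by rewrite ltW.
by rewrite /ascending (le_trans (XM _))// expfzDr ?gt_eqF// mulrA.
Qed.

End IntSeries.

Section SumLt.
Variable R : realType.
Implicit Types (X Y : int -> R) (n : int).

Definition sum_lt n X : R := limn (series (descending (n - 1) X)).

Lemma sum_ltS n X : abscvg (descending (n - 1) X) ->
  sum_lt (n + 1) X = X n + sum_lt n X.
Proof.
move=> /abscvg_cvg cX.
have E : (fun k => descending (n + 1 - 1) X k.+1) = descending (n - 1) X.
  by apply/funext => k; rewrite descendingS addrK.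
rewrite /sum_lt lim_series_recl ?E// descending0 addrK//.
Qed.

Lemma sum_ltD n X Y : abscvg (descending (n - 1) X) ->
  abscvg (descending (n - 1) Y) ->
  sum_lt n (fun j => X j + Y j) = sum_lt n X + sum_lt n Y.
Proof. by move=> /abscvg_cvg cX /abscvg_cvg cY; rewrite /sum_lt -lim_seriesD. Qed.

Lemma sum_ltZ n c X : abscvg (descending (n - 1) X) ->
  sum_lt n (fun j => c * X j) = c * sum_lt n X.
Proof.
by move=> /abscvg_cvg cX; rewrite -[RHS]/(c *: _) /sum_lt -lim_seriesZ.
Qed.

Lemma sum_lt_telescope n X Y : (forall j, X j = Y (j + 1) - Y j) ->
  abscvg (descending n Y) -> sum_lt n X = Y n.
Proof.
move=> XY cY; apply/cvg_lim => //.
rewrite -[Y n]descending0; apply: cvg_telescope; last exact: abscvg_cvg0.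
move=> k; rewrite descendingS /descending XY; congr (Y _ - _); lia.
Qed.

End SumLt.

(** * The two operators on radial functions, as series *)

Section RadialInversion.
Variables (R : realType) (q a g M u0 : R) (phi w L : int -> R).
Hypotheses (g_gt1 : 1 < g) (g_lt_q : g < q) (g_lt_a : g < a).
Hypothesis phi_le : forall j, `|phi j| <= M * g ^ (- j).
Hypothesis L_step : forall j, L (j + 1) = L j - (1 - a^-1) * (a / q) ^ j.

Let g_gt0 : 0 < g. Proof. exact: lt_trans g_gt1. Qed.
Let q_gt0 : 0 < q. Proof. exact: lt_trans g_lt_q. Qed.
Let a_gt0 : 0 < a. Proof. exact: lt_trans g_lt_a. Qed.
Let q_gt1 : 1 < q. Proof. exact: lt_trans g_lt_q. Qed.
Let a_gt1 : 1 < a. Proof. exact: lt_trans g_lt_a. Qed.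
Let q1_neq0 : q - 1 != 0. Proof. by rewrite subr_eq0 gt_eqF. Qed.
Let a1_neq0 : a - 1 != 0. Proof. by rewrite subr_eq0 gt_eqF. Qed.
Let g_lt_aq : g < a * q.
Proof. by rewrite (lt_trans g_lt_q)// ltr_pMl. Qed.
Let q_neq0 : q != 0. Proof. by rewrite gt_eqF. Qed.
Let a_neq0 : a != 0. Proof. by rewrite gt_eqF. Qed.
Let qV : 0 <= q^-1 < 1.
Proof. by rewrite invr_ge0 ltW//= invf_lt1. Qed.
Let aV : 0 <= a^-1 < 1.
Proof. by rewrite invr_ge0 ltW//= invf_lt1. Qed.

Lemma exprz_phi_le c j : 0 < c -> `|c ^ j * phi j| <= M * (c / g) ^ j.
Proof.
move=> c0; rewrite normrM gtr0_norm ?exprz_gt0//.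
rewrite exprzMl ?unitfE ?invr_neq0 ?gt_eqF// exprz_inv mulrCA.
by rewrite ler_pM2l ?exprz_gt0.
Qed.

Lemma abscvg_exprz_phi c n : g < c ->
  abscvg (descending n (fun j => c ^ j * phi j)).
Proof.
move=> gc; apply: (@abscvg_descending_exprz _ _ M (c / g)).
  by rewrite ltr_pdivlMr// mul1r.
by move=> j; apply: exprz_phi_le; exact: lt_trans gc.
Qed.

(** The dominating sequence [(L_n - L_j) K c^j] satisfies a first-order recursion
    with ratio [1/c] and geometric right-hand side [(a c / q)^j]. *)
Lemma abscvg_kernel n m X c K : 1 < c -> q < a * c ->
  (forall j, `|X j| <= K * c ^ j) ->
  abscvg (descending m (fun j => (L n - L j) * X j)).
Proof.
move=> c1 qac XK; have c0 : 0 < c by exact: lt_trans c1.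
have cN0 : c != 0 by rewrite gt_eqF.
have cV : 0 <= c^-1 < 1 by rewrite invr_ge0 ltW//= invf_lt1.
apply: (@abscvg_le _ _ (fun k => `|descending m (fun j => (L n - L j) * (K * c ^ j)) k|)).
  move=> k; rewrite /descending !normrM ler_wpM2l// -normrM.
  exact: le_trans (XK _) (ler_norm _).
apply: (@abscvg_descending_rec _ _
  (fun j => - ((1 - a^-1) * K * (a * c / q) ^ j)) c^-1) => //.
  apply: (@abscvg_descending_exprz _ _ `|(1 - a^-1) * K| (a * c / q)).
    by rewrite ltr_pdivlMr// mul1r.
  by move=> j; rewrite normrN normrM (gtr0_norm (exprz_gt0 _ _))// divr_gt0// mulr_gt0.
move=> j; rewrite L_step (exprz_addn1 cN0).
rewrite !exprzMl ?unitfE ?mulf_neq0 ?invr_neq0//.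
by field; rewrite ?(q_neq0, a_neq0, cN0).
Qed.

Let x j := q ^ j * phi j.

Let abscvg_x n : abscvg (descending n x). Proof. exact: abscvg_exprz_phi. Qed.

Lemma abscvg_kernel_phi n m : abscvg (descending m (fun j => (L n - L j) * x j)).
Proof.
apply: (@abscvg_kernel _ _ _ (q / g) M).
- by rewrite ltr_pdivlMr// mul1r.
- by rewrite mulrA ltr_pdivlMr// mulrC ltr_pM2r.
- by move=> j; exact: exprz_phi_le.
Qed.

Lemma abscvg_kernel_cst n m :
  abscvg (descending m (fun j => (L n - L j) * q ^ j)).
Proof.
apply: (@abscvg_kernel _ _ _ q 1) => //.
- by rewrite ltr_pMl.
- by move=> j; rewrite mul1r gtr0_norm ?exprz_gt0.
Qed.

(** Abel summation: [(q - 1) (L_n - L_j) q^j] is the increment at [j] of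
    [q^j (L_n - L_j) - q a^(j-1)], because [L] has increments
    [- (1 - 1/a) (a/q)^j].  Up to a factor this is the coefficient of [psi_n]
    in the value of [I^alpha psi] at radius [q^n]. *)
Lemma sum_lt_kernel_cst n :
  sum_lt n (fun j => (L n - L j) * q ^ j) = - (q / (q - 1) * a ^ (n - 1)).
Proof.
pose Y j := (q - 1)^-1 * ((L n - L j) * q ^ j) + - (q / (q - 1) / a) * a ^ j.
rewrite (@sum_lt_telescope _ _ _ Y).
- rewrite /Y subrr mul0r mulr0 add0r exprz_sub1//; ring.
- move=> j; rewrite /Y !exprz_addn1// L_step exprzMl ?unitfE ?invr_neq0// exprz_inv -invr_expz.
  have := @expfz_neq0 _ q j q_neq0; move: (q ^ j) (a ^ j) => qj aj qj0.
  by field; rewrite ?(q_neq0, a_neq0, qj0, q1_neq0, a1_neq0).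
apply: abscvg_descendingD; first by apply: abscvg_descendingZ; exact: abscvg_kernel_cst.
apply: abscvg_descendingZ; apply: (@abscvg_descending_exprz _ _ 1 a) => //.
by move=> j; rewrite mul1r gtr0_norm ?exprz_gt0.
Qed.

Let S n := sum_lt n x.

Let S_step n : S (n + 1) = S n + x n.
Proof. by rewrite /S sum_ltS// addrC. Qed.

(** Raising [n] by one changes every kernel value [L_n - L_j] by the same amount
    [- (1 - 1/a) (a/q)^n], and the new term [j = n] has to be included in [S]. *)
Lemma sum_lt_kernel_step n :
  sum_lt (n + 1) (fun j => (L (n + 1) - L j) * x j) =
  sum_lt n (fun j => (L n - L j) * x j) - (1 - a^-1) * (a / q) ^ n * S (n + 1).
Proof.
rewrite sum_ltS; last exact: abscvg_kernel_phi.
rewrite (_ : (fun j => (L (n + 1) - L j) * x j) =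
  fun j => (L n - L j) * x j + (- ((1 - a^-1) * (a / q) ^ n)) * x j); last first.
  by apply/funext => j; rewrite L_step; ring.
rewrite sum_ltD; [|exact: abscvg_kernel_phi|by apply: abscvg_descendingZ; exact: abscvg_x].
by rewrite sum_ltZ// S_step L_step /S; ring.
Qed.

Hypothesis solutionE : forall n, w n = u0 + (1 - q^-1) *
  (sum_lt n (fun j => (L n - L j) * x j) -
   phi n * sum_lt n (fun j => (L n - L j) * q ^ j)).

Lemma solution_step n : w (n + 1) = w n
  - (1 - q^-1) * (1 - a^-1) * (a / q) ^ n * S (n + 1)
  + a ^ n * phi (n + 1) - a^-1 * a ^ n * phi n.
Proof.
rewrite !solutionE sum_lt_kernel_step !sum_lt_kernel_cst addrK.
rewrite exprz_sub1//.
by field; rewrite ?(q_neq0, a_neq0, q1_neq0, a1_neq0).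
Qed.

(** [Z] is the part of the antiderivative of [lower] that contains [S]; it
    satisfies [Z_j = Z_(j+1) / a - q^j a^(j-1) phi_j]. *)
Let Z j := a^-1 * a ^ j * S j.

Let abscvg_Z n : abscvg (descending n Z).
Proof.
apply: (@abscvg_descending_rec _ _ (fun j => - (a^-1) * ((a * q) ^ j * phi j)) a^-1) => //.
  by apply: abscvg_descendingZ; exact: abscvg_exprz_phi.
move=> j; rewrite /Z S_step exprz_addn1// exprzMl ?unitfE// /x.
by field.
Qed.

(** [lower n] and [upper n] are the terms of the series for the operator
    [D^alpha] coming from the ball around the point and from the complement of
    the ball around the origin, up to constant factors. *)
Let lower n j := q ^ j * (w j - w n).

Lemma abscvg_lower n m : abscvg (descending m (lower n)).
Proof.
apply: (@abscvg_descending_rec _ _ (fun j =>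
  ((1 - q^-1) * (1 - a^-1)) * Z (j + 1)
  + ((- (a * q)^-1) * ((a * q) ^ (j + 1) * phi (j + 1))
  + a^-1 * ((a * q) ^ j * phi j))) q^-1) => //.
  apply: abscvg_descendingD; first by apply: abscvg_descendingZ; rewrite descending_shift.
  apply: abscvg_descendingD.
    apply: abscvg_descendingZ.
    by rewrite (@descending_shift _ m (fun j => (a * q) ^ j * phi j)); exact: abscvg_exprz_phi.
  by apply: abscvg_descendingZ; exact: abscvg_exprz_phi.
move=> j; rewrite /lower solution_step /Z !exprz_addn1 ?mulf_neq0// !exprzMl ?unitfE ?invr_neq0//.
rewrite exprz_inv -invr_expz.
have := @expfz_neq0 _ q j q_neq0; move: (q ^ j) (a ^ j) => qj aj qj0.
by field; rewrite ?(q_neq0, a_neq0, qj0, q1_neq0, a1_neq0).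
Qed.

(** The recursion of [w] makes [lower n j] the increment at [j] of
    [(lower n j - a^-1 (a q)^j phi_j) / (q - 1) + Z_j]: the series over [j < n] of
    [(a q)^j phi_j] that both parts produce cancel. *)
Lemma sum_lower n : sum_lt n (lower n) =
  a^-1 * a ^ n * S n - a^-1 * (a * q) ^ n * phi n / (q - 1).
Proof.
pose Y j := (q - 1)^-1 * lower n j + (Z j +
   (- (a^-1 / (q - 1))) * ((a * q) ^ j * phi j)).
rewrite (@sum_lt_telescope _ _ _ Y).
- by rewrite /Y /lower /Z subrr !mulr0; ring.
- move=> j; rewrite /Y /lower solution_step /Z S_step /x !exprz_addn1 ?mulf_neq0// !exprzMl ?unitfE ?invr_neq0//.
  rewrite exprz_inv -invr_expz.
  have := @expfz_neq0 _ q j q_neq0; move: (q ^ j) (a ^ j) => qj aj qj0.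
  by field; rewrite ?(q_neq0, a_neq0, qj0, q1_neq0, a1_neq0).
apply: abscvg_descendingD; first by apply: abscvg_descendingZ; exact: abscvg_lower.
apply: abscvg_descendingD => //.
by apply: abscvg_descendingZ; exact: abscvg_exprz_phi.
Qed.

Let abscvg_phi n : abscvg (ascending n phi).
Proof.
apply: (@abscvg_ascending_exprz _ _ M g^-1).
  by rewrite invr_gt0 g_gt0 invf_lt1.
by move=> j; rewrite exprz_inv.
Qed.

Let abscvg_phiS n : abscvg (ascending n (fun j => phi (j + 1))).
Proof.
by rewrite ascending_shift.
Qed.

(** [P] plays for increasing [j] the role of [Z]; it satisfies
    [P_(j+1) = P_j / q + phi_(j+1)]. *)
Let P j := q ^ (- j) * S (j + 1).

Let abscvg_P n : abscvg (ascending n P).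
Proof.
apply: (@abscvg_ascending_rec _ _ (fun j => phi (j + 1)) q^-1) => //.
move=> j; rewrite /P [S (j + 1 + 1)]S_step /x opprD exprz_sub1//.
rewrite exprz_addn1// -invr_expz.
have := @expfz_neq0 _ q j q_neq0; move: (q ^ j) => qj qj0.
by field; rewrite ?(q_neq0, qj0).
Qed.

Let upper n j := a ^ (- j) * (w j - w n).

Let upper_step n j : upper n (j + 1) = a^-1 * upper n j +
   ((- ((1 - q^-1) * (1 - a^-1) * a^-1)) * P j + (a^-1 * phi (j + 1)
   + (- a^-1 ^+ 2) * phi j)).
Proof.
rewrite /upper /P solution_step opprD exprz_sub1//.
rewrite exprzMl ?unitfE ?invr_neq0// exprz_inv -!invr_expz.
have := @expfz_neq0 _ q j q_neq0; have := @expfz_neq0 _ a j a_neq0.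
move: (q ^ j) (a ^ j) => qj aj aj0 qj0.
by field; rewrite ?(q_neq0, a_neq0, qj0, q1_neq0, a1_neq0).
Qed.

Lemma abscvg_upper n m : abscvg (ascending m (upper n)).
Proof.
apply: (abscvg_ascending_rec aV _ (upper_step n)).
apply: abscvg_ascendingD; first exact: abscvg_ascendingZ.
by apply: abscvg_ascendingD; exact: abscvg_ascendingZ.
Qed.

(** The sum of [phi_j] over [j > n] occurs with total coefficient zero, so that
    [upper n] telescopes as well; since [upper n n = 0] the antiderivative may
    be evaluated at [n] in place of [n + 1]. *)
Lemma sum_upper n : limn (series (ascending (n + 1) (upper n))) =
  - (a^-1 * q ^ (- n) * S (n + 1)) - a^-1 ^+ 2 / (1 - a^-1) * phi n.
Proof.
pose Y j := (1 - a^-1)^-1 * upper n j +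
   ((- a^-1) * P j + (- (a^-1 ^+ 2 / (1 - a^-1))) * phi j).
have YE j : upper n j = Y j - Y (j + 1).
  rewrite /Y upper_step.
  have -> : P (j + 1) = q^-1 * P j + phi (j + 1).
    rewrite /P [S (j + 1 + 1)]S_step /x opprD exprz_sub1//.
    rewrite exprz_addn1// -invr_expz.
    have := @expfz_neq0 _ q j q_neq0; move: (q ^ j) => qj qj0.
    by field; rewrite ?(q_neq0, qj0).
  by field; rewrite ?(q_neq0, a_neq0, q1_neq0, a1_neq0).
have Yn : Y n = upper n n + Y (n + 1) by rewrite YE; ring.
have <- : Y (n + 1) = - (a^-1 * q ^ (- n) * S (n + 1)) - a^-1 ^+ 2 / (1 - a^-1) * phi n.
  move: Yn; rewrite /upper subrr mulr0 add0r => <-.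
  by rewrite /Y /upper /P subrr !mulr0 add0r; ring.
apply/cvg_lim => //; rewrite -[Y (n + 1)]ascending0; apply: cvg_telescope.
  by move=> k; rewrite ascendingS /ascending YE.
apply: abscvg_cvg0.
apply: abscvg_ascendingD; first by apply: abscvg_ascendingZ; exact: abscvg_upper.
by apply: abscvg_ascendingD; exact: abscvg_ascendingZ.
Qed.

(** Both sums contain [a^-1 q^-n S_n], with opposite signs; the remaining
    coefficient of [phi n] is the inverse of the product of the constants in
    front. *)
Lemma radial_inversion n :
  (1 - a) / (1 - (a * q)^-1) * ((1 - q^-1) *
  (limn (series (ascending (n + 1) (upper n))) + (a * q) ^ (- n) * sum_lt n (lower n))) = phi n.
Proof.
rewrite sum_upper sum_lower S_step /x -!invr_expz exprzMl ?unitfE//.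
have := @expfz_neq0 _ q n q_neq0; have := @expfz_neq0 _ a n a_neq0.
move: (q ^ n) (a ^ n) => qj aj aj0 qj0.
field; rewrite a_neq0 q_neq0 qj0 aj0 !subr_eq0 /=.
by rewrite !gt_eqF// (lt_trans g_gt1).
Qed.

End RadialInversion.

(** * Balls in the p-adic numbers *)

Section PadicGeometry.
Variables (R : realType) (p : nat) (p_prime : prime p).
Local Notation Zp := (padic_int p_prime).
Local Notation Qp := (padic p_prime).
Local Notation nm := (@padic_norm p p_prime R).
Local Notation q := (p%:R : R).
Implicit Types (x y z t : Qp) (n : int).

Lemma prime_natr_gt1 : 1 < q. Proof. by rewrite ltr1n prime_gt1. Qed.
Let q_gt0 : 0 < q := lt_trans ltr01 prime_natr_gt1.
Let q_neq0 : q != 0. Proof. by rewrite gt_eqF. Qed.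

(** The topology is defined with the rational-valued norm, the operators with
    the real-valued one. *)
Lemma padic_norm_ratr x : nm x = ratr (padic_norm rat x).
Proof.
have E (a : Zp) : padic_int_norm R a = ratr (padic_int_norm rat a).
  rewrite /padic_int_norm; case: ifP => _; first by rewrite rmorph0.
  by rewrite fmorphV rmorphXn rmorph_nat.
by rewrite /padic_norm !E fmorph_div.
Qed.

Lemma padic_norm_exprz x : x != 0 -> exists n, nm x = q ^ n.
Proof.
move=> x0; move: (padic_norm_eq0 R x); rewrite (negPf x0) /padic_norm.
rewrite /padic_int_norm.
case: ifP => [_|_]; first by rewrite mul0r eqxx.
case: ifP => [_|_]; first by rewrite invr0 mulr0 eqxx.
set i := padic_int_val _; set j := padic_int_val _ => _.
by exists (j%:Z - i%:Z); rewrite expfzDr// -exprnN invrK mulrC.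
Qed.

Lemma padic_normB x y : nm (x - y) = nm (y - x).
Proof. by rewrite -opprB padic_normN. Qed.

Lemma padic_norm_subl x y z : nm (x - z) <= Num.max (nm (x - y)) (nm (y - z)).
Proof. by rewrite (le_trans _ (padic_normD _ _ _))// addrA subrK. Qed.

Lemma padic_norm_sub_lt x y : nm y < nm x -> nm (x - y) = nm x.
Proof.
move=> yx; apply/le_anti; apply/andP; split.
  by rewrite (le_trans (padic_normD _ _ _))// padic_normN ge_max lexx ltW.
have := padic_normD R (x - y) y; rewrite subrK le_max => /orP[//|xy].
by move: (le_lt_trans xy yx); rewrite ltxx.
Qed.

Definition pball x n : set Qp := [set y | nm (y - x) <= q ^ n].

Lemma pball_open x n : padic_open (pball x n).
Proof.
move=> y yx; exists ((p%:R : rat) ^ n); first by rewrite exprz_gt0// ltr0n prime_gt0.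
move=> z; rewrite -(ltr_rat R) -padic_norm_ratr.
have -> : ratr ((p%:R : rat) ^ n) = q ^ n.
  by rewrite fmorphXz rmorph_nat.
move=> /ltW zy; rewrite /pball /= (le_trans (padic_norm_subl z y x))//.
by rewrite ge_max zy.
Qed.

Lemma measurable_pball x n : measurable (pball x n).
Proof. by apply: sub_sigma_algebra; exact: pball_open. Qed.

Lemma padic_norm_natX (k : int) : nm ((p%:R : Qp) ^ k) = q ^ (- k).
Proof.
have nmX (x : Qp) (m : nat) : nm (x ^+ m) = nm x ^+ m.
  elim: m => [|m IH].
    rewrite !expr0; have N0 : nm 1 != 0 by rewrite padic_norm_eq0 oner_neq0.
    by apply: (mulfI N0); rewrite -padic_normM !mulr1.
  by rewrite !exprS padic_normM IH.
case: k => m.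
  by rewrite -exprnP nmX padic_norm_prime -exprnN exprVn.
rewrite NegzE opprK -exprnN.
have X0 : (p%:R : Qp) ^+ m.+1 != 0.
  by rewrite -(padic_norm_eq0 R) nmX padic_norm_prime expf_eq0 invr_eq0 (negPf q_neq0) andbF.
have N0 : nm (p%:R ^+ m.+1) != 0 by rewrite padic_norm_eq0.
apply: (mulIf N0); rewrite -padic_normM mulVf// nmX padic_norm_prime exprVn -exprnP mulfV ?expf_neq0//.
have E1 : nm 1 != 0 by rewrite padic_norm_eq0 oner_neq0.
by apply: (mulfI E1); rewrite -padic_normM !mulr1.
Qed.

Lemma padic_norm_of_int (a : Zp) : nm (padic_of_int a) = padic_int_norm R a.
Proof.
have := padic_norm_frac R a (oner_neq0 Zp).
by rewrite /padic_of_int tofrac1 divr1 padic_int_norm1 divr1.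
Qed.

Lemma padic_norm_natr (k : nat) : ~~ (p %| k)%N -> nm k%:R = 1.
Proof.
move=> pk; have [|//|a0 av] := @padic_int_val_unique p p_prime k%:R 0 (k%:Z %% p%:Z)%Z.
- by rewrite padic_int_natE !expn0 expn1 mulr1.
- by apply: contra pk => /dvdz_mod0P; rewrite modz_mod => /dvdz_mod0P.
- rewrite -[k%:R](rmorph_nat (@FracField.tofrac _)) -/(padic_of_int _) padic_norm_of_int.
  by rewrite /padic_int_norm (negPf a0) av expr0 invr1.
Qed.

Lemma padic_int_norm_le (a : Zp) (n : nat) :
  (padic_int_norm R a <= q ^- n) = (a n == 0).
Proof.
rewrite /padic_int_norm; have [->|a0] := eqVneq a 0.
  by rewrite padic_int0E eqxx invr_ge0 exprn_ge0// ltW.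
rewrite -padic_int_val_ge// lef_pV2 ?posrE ?exprn_gt0//.
by rewrite ler_eXn2l// prime_natr_gt1.
Qed.

(** Representatives of the residue field.  Write [x = a / b] with [p]-adic
    integers and [|a| <= |b| = q^-v].  Modulo [p^(v+1)] one has [b = z p^v] with
    [z] prime to [p] and [a = y p^v], so [i = y / z] modulo [p] makes
    [a - i b] divisible by [p^(v+1)]. *)
Lemma padic_residue x : nm x <= 1 -> exists2 i, (i < p)%N & nm (x - i%:R) <= q^-1.
Proof.
rewrite [x]padic_fracE; set a := (frac _).1; set b := (frac _).2.
have b0 : b != 0 by exact: denom_ratioP.
have nb_gt0 : 0 < padic_int_norm R b.
  by rewrite lt_def padic_int_norm_eq0 b0 padic_int_norm_ge0.
rewrite padic_norm_frac// ler_pdivrMr// mul1r.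
have [z bz pz] := padic_int_valP b0; set v := padic_int_val b in bz.
have nb : padic_int_norm R b = q ^- v by rewrite /padic_int_norm (negPf b0).
rewrite nb padic_int_norm_le => /eqP av0.
have /dvdzP[y ay] : ((p ^ v)%N%:Z %| a v.+1)%Z.
  by apply/dvdz_mod0P; rewrite -residueP.
have /coprimezP[[u w] /= uw] : coprimez z p%:Z.
  by rewrite coprimezE coprime_sym prime_coprime.
have p_gt0 : (0 : int) < p%:Z by rewrite ltz_nat prime_gt0.
have [i iE] : exists i : nat, i%:Z = (y * u %% p%:Z)%Z.
  by exists `|(y * u %% p%:Z)%Z|%N; rewrite gez0_abs// modz_ge0// gt_eqF.
exists i; first by rewrite -ltz_nat iE ltz_pmod.
have -> : padic_of_int a / padic_of_int b - i%:R =
    padic_of_int (a - i%:R * b) / padic_of_int b.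
  rewrite /padic_of_int tofracB tofracM rmorph_nat mulrBl mulfK// tofrac_eq0//.
rewrite padic_norm_frac// ler_pdivrMr// nb -invfM -exprS padic_int_norm_le.
rewrite padic_intDE padic_intNE padic_intME padic_int_natE ay bz.
rewrite modzMml modzNm modzDmr; apply/eqP/dvdz_mod0P.
rewrite mulrA -mulrBl expnS PoszM dvdz_mul//.
apply/dvdz_mod0P; rewrite iE -modzDmr -modzNm modzMml modzNm modzDmr.
have -> : y - y * u * z = y * w * p%:Z.
  by rewrite -[y in LHS]mulr1 -{1}uw; ring.
by rewrite modzMl.
Qed.

End PadicGeometry.

(** * Integrals of functions constant on pieces *)

Section Pieces.
Context {d : measure_display} {T : measurableType d} {R : realType}.
Variable mu : {measure set T -> \bar R}.

Lemma eseries_EFin (x : nat -> R) : cvgn (series x) ->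
  (\sum_(0 <= k <oo) (x k)%:E)%E = (limn (series x))%:E.
Proof.
move=> cx; rewrite -EFin_lim//; apply/congr_lim/funext => n /=.
by rewrite sumEFin.
Qed.

Lemma integral_countable_pieces (E : nat -> set T) (c m : nat -> R) (h : T -> R) :
  trivIset setT E -> (forall k, measurable (E k)) ->
  (forall k, mu (E k) = (m k)%:E) -> (forall k x, E k x -> h x = c k) ->
  abscvg (fun k => m k * c k) ->
  mu.-integrable (\bigcup_k E k) (EFin \o h) /\
  \int[mu]_(x in \bigcup_k E k) h x = limn (series (fun k => m k * c k)).
Proof.
move=> tE mE muE hE cvg_mc.
have m_ge0 k : 0 <= m k by rewrite -lee_fin -muE.
have intE (g : R -> R) k : (\int[mu]_(x in E k) (g (h x))%:E)%E = (m k * g (c k))%:E.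
  rewrite (eq_integral (cst (g (c k))%:E)); last first.
    by move=> x /[1!inE] Ex /=; rewrite (hE k).
  by rewrite integral_cst// muE -EFinM mulrC.
have mh : measurable_fun (\bigcup_k E k) h.
  apply/(measurable_fun_bigcup _ mE) => k.
  apply: (eq_measurable_fun (cst (c k))); last exact: measurable_cst.
  by move=> x /[1!inE] Ex /=; rewrite (hE k).
have ih : mu.-integrable (\bigcup_k E k) (EFin \o h).
  apply/integrableP; split; first exact/measurable_EFinP.
  rewrite ge0_integral_bigcup//; last first.
    by apply/measurableT_comp => //; exact/measurable_EFinP.
  rewrite (eq_eseriesr (g := fun k => `|m k * c k|%:E)).
    by rewrite eseries_EFin// ltry.
  by move=> k _ /=; rewrite (intE Num.norm) normrM ger0_norm.
split=> //; rewrite /Rintegral integral_bigcup//.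
rewrite (eq_eseriesr (g := fun k => (m k * c k)%:E)).
  by rewrite eseries_EFin//; exact: abscvg_cvg.
by move=> k _; rewrite -(intE id).
Qed.

Lemma integrable_disjointU (A B : set T) (f : T -> \bar R) :
  measurable A -> measurable B -> [disjoint A & B] ->
  mu.-integrable A f -> mu.-integrable B f -> mu.-integrable (A `|` B) f.
Proof.
move=> mA mB AB /integrableP[mfA fA] /integrableP[mfB fB].
have mf : measurable_fun (A `|` B) f by apply/measurable_funU.
apply/integrableP; split => //.
rewrite integral_setU//; first exact: lte_add_pinfty.
by apply: measurableT_comp.
Qed.

(** The integrands of both operators vanish off two disjoint sets on which they
    are computed separately. *)
Lemma integral_two_pieces (A B D : set T) (h : T -> R) :
  measurable A -> measurable B -> measurable D -> [disjoint A & B] ->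
  A `<=` D -> B `<=` D -> (forall x, D x -> ~ A x -> ~ B x -> h x = 0) ->
  mu.-integrable A (EFin \o h) -> mu.-integrable B (EFin \o h) ->
  mu.-integrable D (EFin \o h) /\
  \int[mu]_(x in D) h x = \int[mu]_(x in A) h x + \int[mu]_(x in B) h x.
Proof.
move=> mA mB mD dAB AD BD h0 iA iB.
set C := D `\` (A `|` B).
have mC : measurable C by apply: measurableD => //; exact: measurableU.
have DE : D = (A `|` B) `|` C by rewrite setDUK// subUset.
have C0 : {in C, cst 0%E =1 (EFin \o h : T -> \bar R)}.
  move=> x /set_mem -[Dx ABx]; rewrite /cst /= h0// => ?; apply: ABx.
    by left.
  by right.
have iC : mu.-integrable C (EFin \o h).
  by apply: (eq_integrable mC _ _ C0); exact: integrable0.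
have dC : [disjoint A `|` B & C] by apply/disj_setPS => x [? []].
have iAB : mu.-integrable (A `|` B) (EFin \o h) by exact: integrable_disjointU.
have iD : mu.-integrable ((A `|` B) `|` C) (EFin \o h).
  by apply: integrable_disjointU => //; exact: measurableU.
split; first by rewrite DE.
rewrite DE Rintegral_setU//; last exact: measurableU.
rewrite Rintegral_setU// [X in _ + X](_ : _ = 0) ?addr0//.
by rewrite /Rintegral -(eq_integral _ _ C0) integral0.
Qed.

End Pieces.

(** * The Haar measure of balls and spheres *)

Section PadicHaar.
Variables (R : realType) (p : nat) (p_prime : prime p).
Local Notation Qp := (padic p_prime).
Local Notation nm := (@padic_norm p p_prime R).
Local Notation q := (p%:R : R).
Implicit Types (x y z t : Qp) (n : int).

Let q_gt1 : 1 < q := prime_natr_gt1 R p_prime.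
Let q_gt0 : 0 < q := lt_trans ltr01 q_gt1.
Let q_neq0 : q != 0. Proof. by rewrite gt_eqF. Qed.

Lemma padic_norm_inj x m n : nm x = q ^ m -> nm x = q ^ n -> m = n.
Proof. by move=> -> /ieexprIz; apply => //; rewrite gt_eqF. Qed.

Definition psphere x n : set Qp := [set y | nm (y - x) = q ^ n].

Lemma psphereE x n : psphere x n = pball R x n `\` pball R x (n - 1).
Proof.
apply/seteqP; split => y; rewrite /psphere /pball /=.
  by move=> ->; split => //; rewrite ler_eXz2l//; apply/negP; rewrite -ltNge ltrBlDr ltrDl.
case: (eqVneq (y - x) 0) => [->|yx0 []].
  by rewrite padic_norm0 => -[_ []]; rewrite exprz_ge0// ltW.
have [m ->] := padic_norm_exprz R yx0.
rewrite !ler_eXz2l// => mn /negP; rewrite -ltNge => nm'.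
by congr (_ ^ _); lia.
Qed.

Lemma measurable_psphere x n : measurable (psphere x n).
Proof. by rewrite psphereE; apply: measurableD; exact: measurable_pball. Qed.

Lemma set1_pball x : [set x] = \bigcap_k pball R x (- k%:Z).
Proof.
apply/seteqP; split => [y -> k _|y yx].
  by rewrite /pball /= subrr padic_norm0 exprz_ge0// ltW.
apply: contrapT => /eqP; rewrite -subr_eq0 => yx0.
have [m E] := padic_norm_exprz R yx0.
have := yx (`|m| + 1)%N I; rewrite /pball /= E ler_eXz2l//; lia.
Qed.

Lemma measurable_padic1 x : measurable [set x].
Proof. by rewrite set1_pball; apply: bigcapT_measurable => k; exact: measurable_pball. Qed.

(** The centre is added as piece number [0] because no sphere contains it. *)
Lemma pball_pieces x n : pball R x n =
  \bigcup_k (if k is k'.+1 then psphere x (n - k'%:Z) else [set x]).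
Proof.
apply/seteqP; split => y; last first.
  case=> -[|k] _ /=; first by move->; rewrite /pball /= subrr padic_norm0 exprz_ge0// ltW.
  by rewrite /psphere /pball /= => ->; rewrite ler_eXz2l//; lia.
rewrite /pball /= => yx.
have [|yx0] := eqVneq (y - x) 0.
  by move/eqP; rewrite subr_eq0 => /eqP ->; exists 0%N.
have [m E] := padic_norm_exprz R yx0.
move: yx; rewrite E ler_eXz2l// => mn.
exists (absz (n - m)%R).+1 => //=; rewrite /psphere /= E; congr (_ ^ _); lia.
Qed.

Lemma padic_outer_pieces n :
  [set y | q ^ n < nm y] = \bigcup_k psphere 0 (n + 1 + k%:Z).
Proof.
apply/seteqP; split => y; rewrite /psphere /=; last first.
  by case=> k _ /=; rewrite subr0 => ->; rewrite ltr_eXz2l//; lia.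
have [->|y0] := eqVneq y 0.
  by rewrite padic_norm0 => /lt_geF; rewrite exprz_ge0// ltW.
have [m E] := padic_norm_exprz R y0.
rewrite E ltr_eXz2l// => nm'.
exists (absz (m - n - 1)%R) => //=; rewrite subr0 E; congr (_ ^ _); lia.
Qed.

Lemma pball_translate x z n : [set x + y | y in pball R z n] = pball R (x + z) n.
Proof.
apply/seteqP; split => y.
  by case=> w wz <-; rewrite /pball /= opprD addrACA subrr add0r.
rewrite /pball /= => yxz; exists (y - x); last by rewrite addrC subrK.
by rewrite -addrA -opprD.
Qed.

(** After scaling by [p^(n+1)] this is the decomposition of the unit ball into
    the residue classes of [0, ..., p - 1]. *)
Lemma pball_cosets n : pball R (0 : Qp) (n + 1) =
  \bigcup_(i < p) pball R (i%:R * p%:R ^ (- (n + 1))) n.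
Proof.
apply/seteqP; split => y.
  rewrite /pball /= subr0 => yn.
  have pX0 : (p%:R : Qp) ^ (n + 1) != 0.
    by rewrite -(padic_norm_eq0 R) padic_norm_natX expfz_neq0.
  have [|i ip yi] := @padic_residue R p p_prime (y * p%:R ^ (n + 1)).
    by rewrite padic_normM padic_norm_natX -invr_expz ler_pdivrMr ?exprz_gt0// mul1r.
  exists i => //; rewrite /pball /=.
  rewrite -[y - _](mulfK pX0) invr_expz padic_normM padic_norm_natX opprK mulrBl.
  rewrite -invr_expz divfK//.
  apply: (le_trans (ler_wpM2r _ yi)); first by rewrite exprz_ge0 ?ltW.
  by rewrite exprz_addn1// mulrC mulfK.
case=> i ip; rewrite /pball /= subr0 => yi.
rewrite -[y](subrK (i%:R * p%:R ^ (- (n + 1)))) (le_trans (padic_normD _ _ _))//.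
rewrite ge_max (le_trans yi) ?ler_eXz2l ?lerDl//= padic_normM padic_norm_natX opprK.
apply: ler_piMl; first by rewrite exprz_ge0 ?ltW.
have [->|i0] := posnP i; first by rewrite padic_norm0.
by rewrite padic_norm_natr ?gtnNdvd.
Qed.

Lemma pball_cosets_disjoint n : trivIset `I_p
  (fun i => pball R ((i%:R : Qp) * p%:R ^ (- (n + 1))) n).
Proof.
have lt_disj i j y : (i < j < p)%N ->
    pball R ((i%:R : Qp) * p%:R ^ (- (n + 1))) n y ->
    ~ pball R ((j%:R : Qp) * p%:R ^ (- (n + 1))) n y.
  move=> /andP[ij jp]; rewrite /pball /= => yi yj.
  have := padic_norm_subl R (j%:R * p%:R ^ (- (n + 1)) : Qp) y
    (i%:R * p%:R ^ (- (n + 1))).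
  rewrite (padic_normB R (_ * _) y) le_max => /orP h.
  have : nm (j%:R * p%:R ^ (- (n + 1)) - i%:R * p%:R ^ (- (n + 1))) <= q ^ n.
    by case: h => h; exact: le_trans h _.
  rewrite -mulrBl -natrB; last exact: ltnW.
  rewrite padic_normM padic_norm_natX opprK padic_norm_natr ?mul1r; last first.
    by rewrite gtnNdvd ?subn_gt0// (leq_ltn_trans (leq_subr _ _)).
  by rewrite ler_eXz2l// gerDl.
move=> i j /= ip jp [y [yi yj]].
have [ij|ij|//] := ltngtP i j.
- by have := @lt_disj i j y; rewrite ij jp => /(_ isT yi).
- by have := @lt_disj j i y; rewrite ij ip => /(_ isT yj).
Qed.

Variable mu : {measure set Qp -> \bar R}.
Hypothesis mu_haar : normalized_haar mu.

Lemma haar_pball_center x n : mu (pball R x n) = mu (pball R (0 : Qp) n).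
Proof.
have [mut _] := mu_haar.
by rewrite -(mut x (pball R (0 : Qp) n) (measurable_pball R 0 n)) pball_translate addr0.
Qed.

Lemma haar_pball_step n :
  mu (pball R (0 : Qp) (n + 1)) = (q%:E * mu (pball R (0%R : Qp) n))%E.
Proof.
have mB i : (i < p)%N ->
    measurable (pball R ((i%:R : Qp) * p%:R ^ (- (n + 1))) n).
  by move=> _; exact: measurable_pball.
rewrite pball_cosets bigcup_mkord.
rewrite (measure_semi_additive_ord_I mu
  (F := fun i => pball R ((i%:R : Qp) * p%:R ^ (- (n + 1))) n))//; last 2 first.
- exact: pball_cosets_disjoint.
- by apply: bigsetU_measurable => i _; exact: measurable_pball.
rewrite (eq_bigr (fun=> mu (pball R (0 : Qp) n))); last by move=> i _; exact: haar_pball_center.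
by rewrite mule_natl sumr_const card_ord.
Qed.

(** The step of the radius determines all values from the unit ball.  For
    negative exponents it is used backwards, which requires excluding
    an infinite measure. *)
Lemma haar_pball x n : mu (pball R x n) = (q ^ n)%:E.
Proof.
rewrite haar_pball_center.
have mu0 : mu (pball R (0 : Qp) 0) = 1%E.
  have [_ <-] := mu_haar; congr (mu _); apply/seteqP; split => y;
  by rewrite /pball /= subr0 expr0z.
case: n => n; elim: n => [|n IH].
- by rewrite mu0.
- by rewrite -addn1 PoszD haar_pball_step IH exprz_addn1// EFinM muleC.
- have := haar_pball_step (-1); rewrite addNr mu0 NegzE.
  case: (mu (pball R (0 : Qp) (-1))) => [r [] E| |].
  + by congr _%:E; rewrite -exprnN expr1; apply: (mulfI q_neq0); rewrite -E mulfV.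
  + by rewrite gt0_muley ?lte_fin.
  + by rewrite gt0_muleNy ?lte_fin.
- have := haar_pball_step (Negz n.+1).
  rewrite (_ : Negz n.+1 + 1 = Negz n); last by rewrite !NegzE; lia.
  rewrite IH.
  case: (mu (pball R (0 : Qp) (Negz n.+1))) => [r [] E| |].
  + congr _%:E; apply: (mulfI q_neq0); rewrite -E mulrC -exprz_addn1//.
    by congr (_ ^ _); rewrite !NegzE; lia.
  + by rewrite gt0_muley ?lte_fin.
  + by rewrite gt0_muleNy ?lte_fin.
Qed.

Lemma haar_psphere x n : mu (psphere x n) = (q ^ n * (1 - q^-1))%:E.
Proof.
have fin : (mu (pball R x n) < +oo)%E by rewrite haar_pball ltry.
have IE : pball R x n `&` pball R x (n - 1) = pball R x (n - 1).
  apply/setIidPr => y; rewrite /pball /= => /le_trans; apply.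
  by rewrite ler_eXz2l// gerBl.
transitivity (mu (pball R x n) - mu (pball R x (n - 1)%R))%E; last first.
  by rewrite !haar_pball -EFinB exprz_sub1// mulrBr mulr1.
rewrite -[in RHS]IE psphereE; apply: (measureD _ _ fin); exact: measurable_pball.
Qed.

Lemma haar_padic1 x : mu [set x] = 0%E.
Proof.
apply/eqP; rewrite eq_le measure_ge0 andbT.
have le k : (mu [set x] <= (q^-1 ^+ k)%:E)%E.
  rewrite exprVn exprnN -(haar_pball x); apply: le_measure.
  - by rewrite inE; exact: measurable_padic1.
  - by rewrite inE; exact: measurable_pball.
  - by move=> y ->; rewrite /pball /= subrr padic_norm0 exprz_ge0// ltW.
have cvg0 : (fun k => (q^-1 ^+ k)%:E) @ \oo --> 0%E.
  apply: cvg_EFin; first by apply: nearW.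
  apply: cvg_expr; rewrite ger0_norm ?invr_ge0 ?ltW// invf_lt1//.
rewrite -(cvg_lim _ cvg0)//; apply: lime_ge; first exact: cvgP cvg0.
exact: nearW.
Qed.

Lemma pball_integral x n (g : int -> R) (h : Qp -> R) :
  (forall y j, nm (y - x) = q ^ j -> j <= n -> h y = g j) ->
  abscvg (descending n (fun j => q ^ j * g j)) ->
  mu.-integrable (pball R x n) (EFin \o h) /\
  \int[mu]_(y in pball R x n) h y =
    (1 - q^-1) * limn (series (descending n (fun j => q ^ j * g j))).
Proof.
move=> hg cg; rewrite pball_pieces.
pose E k : set Qp := if k is k'.+1 then psphere x (n - k'%:Z) else [set x].
pose m k : R := if k is k'.+1 then q ^ (n - k'%:Z) * (1 - q^-1) else 0.
pose c k : R := if k is k'.+1 then g (n - k'%:Z) else h x.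
have mcS : (fun k => m k.+1 * c k.+1) =
    fun k => (1 - q^-1) * descending n (fun j => q ^ j * g j) k.
  by apply/funext => k; rewrite /= /descending mulrAC mulrC.
have [|||||ih ->] := @integral_countable_pieces _ _ _ mu E c m h.
- move=> i j _ _ [y []]; rewrite /E; case: i j => [|i] [|j] //=; rewrite /psphere /=.
  + by move=> ->; rewrite subrr padic_norm0 => /esym/eqP; rewrite expfz_eq0 (negPf q_neq0) andbF.
  + by move=> /[swap] ->; rewrite subrr padic_norm0 => /esym/eqP; rewrite expfz_eq0 (negPf q_neq0) andbF.
  + by move=> Ei Ej; have := padic_norm_inj Ei Ej; lia.
- by case=> [|k]; [exact: measurable_padic1|exact: measurable_psphere].
- by case=> [|k]; [exact: haar_padic1|exact: haar_psphere].
- case=> [|k] y; first by move->.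
  by move=> yk; apply: hg yk _; lia.
- by apply: abscvg_recl; rewrite mcS; exact: abscvgZ.
- split => //; rewrite lim_series_recl ?mcS /m ?mul0r ?add0r//.
    by rewrite -[RHS]/(_ *: _) -lim_seriesZ//; exact: abscvg_cvg.
  by apply: abscvg_cvg; exact: abscvgZ.
Qed.

Lemma padic_outer_integral n (g : int -> R) (h : Qp -> R) :
  (forall y j, nm y = q ^ j -> n < j -> h y = g j) ->
  abscvg (ascending (n + 1) (fun j => q ^ j * g j)) ->
  mu.-integrable [set y | q ^ n < nm y] (EFin \o h) /\
  \int[mu]_(y in [set y | q ^ n < nm y]) h y =
    (1 - q^-1) * limn (series (ascending (n + 1) (fun j => q ^ j * g j))).
Proof.
move=> hg cg; rewrite padic_outer_pieces.
pose E k : set Qp := psphere 0 (n + 1 + k%:Z).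
pose m k : R := q ^ (n + 1 + k%:Z) * (1 - q^-1).
pose c k : R := g (n + 1 + k%:Z).
have mc : (fun k => m k * c k) =
    fun k => (1 - q^-1) * ascending (n + 1) (fun j => q ^ j * g j) k.
  by apply/funext => k; rewrite /= /ascending /m mulrAC mulrC.
have [|||||ih ->] := @integral_countable_pieces _ _ _ mu E c m h.
- by move=> i j _ _ [y [Ei Ej]]; have := padic_norm_inj Ei Ej; lia.
- by move=> k; exact: measurable_psphere.
- by move=> k; exact: haar_psphere.
- by move=> k y yk; apply: hg; [rewrite -yk subr0|lia].
- by rewrite mc; exact: abscvgZ.
- split => //; rewrite mc.
  by rewrite -[RHS]/(_ *: _) -lim_seriesZ//; exact: abscvg_cvg.
Qed.

End PadicHaar.

(** * Radial functions under the p-adic operators *)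

Lemma powR_exprz (R : realType) (x s : R) (j : int) :
  0 <= x -> (x ^ j) `^ s = (x `^ s) ^ j.
Proof.
move=> x0; rewrite -powR_intmul// -powRrM mulrC powRrM powR_intmul//.
exact: powR_ge0.
Qed.

Lemma powR_lt_exponent (R : realType) (x s t : R) :
  1 < x -> s < t -> x `^ s < x `^ t.
Proof.
move=> x1 st; have x0 : 0 < x by exact: lt_trans x1.
by rewrite /powR gt_eqF// ltr_expR ltr_pM2r// ln_gt0.
Qed.

Lemma lez_subr1 (j n : int) : (j <= n - 1) = (j < n).
Proof. by lia. Qed.

Section RadialOperators.
Variables (R : realType) (p : nat) (p_prime : prime p).
Local Notation Qp := (padic p_prime).
Local Notation nm := (@padic_norm p p_prime R).
Local Notation q := (p%:R : R).
Variable mu : {measure set Qp -> \bar R}.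
Hypothesis mu_haar : normalized_haar mu.
Variable alpha : R.
Hypothesis alpha_gt0 : 0 < alpha.
Implicit Types (x y t : Qp) (n : int).

Let q_gt1 : 1 < q := prime_natr_gt1 R p_prime.
Let q_gt0 : 0 < q := lt_trans ltr01 q_gt1.
Let q_neq0 : q != 0. Proof. by rewrite gt_eqF. Qed.
Let a := q `^ alpha.
Let a_gt1 : 1 < a. Proof. by rewrite -(powRr0 q) powR_lt_exponent. Qed.
Let a_gt0 : 0 < a := lt_trans ltr01 a_gt1.
Let a_neq0 : a != 0. Proof. by rewrite gt_eqF. Qed.

Lemma padic_norm_near n t y : nm t = q ^ n -> pball R t (n - 1) y -> nm y = q ^ n.
Proof.
move=> tn; rewrite /pball /= => yt; rewrite -tn.
rewrite -[y](subKr t) padic_norm_sub_lt// -padic_normB tn (le_lt_trans yt)//.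
by rewrite ltr_eXz2l// gtrBl.
Qed.

Lemma padic_norm_shell n x y : pball R x n y -> ~ pball R x (n - 1) y ->
  nm (y - x) = q ^ n.
Proof. by move=> yn yn1; have : psphere R x n y by rewrite psphereE. Qed.

(** The kernel of the fractional integral is a difference of values of one
    function of the radius; including the constant in front of the integral makes
    the increments of that function uniform in [alpha]
    ([kernel_primitive_step]). *)
Definition kernel_primitive (j : int) : R :=
  fracint_const p alpha *
  (if alpha == 1 then ln (q ^ j) else (q ^ j) `^ (alpha - 1)).
Local Notation L := kernel_primitive.

Let aq_neq1 : alpha != 1 -> 1 - a / q != 0.
Proof.
move=> a1; rewrite subr_eq0 eq_sym; apply: contra a1 => /eqP aq.
have : a = q `^ 1 by rewrite powRr1 ?ltW//; move: aq => /(congr1 ( *%R^~ q)); rewrite divfK// mul1r.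
rewrite /a => E; apply/eqP/le_anti/andP; split; rewrite leNgt; apply/negP => h.
  by have := powR_lt_exponent q_gt1 h; rewrite E ltxx.
by have := powR_lt_exponent q_gt1 h; rewrite E ltxx.
Qed.

Let powR_sub1 : q `^ (alpha - 1) = a / q.
Proof. by rewrite powRB ?q_neq0 ?implybT// powRr1// ltW. Qed.

Lemma fracint_constE : fracint_const p alpha =
  if alpha == 1 then (1 - q) / (q * ln q) else (1 - a^-1) / (1 - a / q).
Proof. by rewrite /fracint_const powRN powR_sub1. Qed.

Let lnq_neq0 : ln q != 0. Proof. by rewrite gt_eqF// ln_gt0. Qed.

Lemma fracint_const_neq0 : fracint_const p alpha != 0.
Proof.
rewrite fracint_constE; case: ifPn => [_|a1].
  by rewrite !mulf_neq0 ?invr_neq0 ?mulf_neq0// subr_eq0 lt_eqF.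
by rewrite mulf_neq0 ?invr_neq0 ?aq_neq1// subr_eq0 gt_eqF// invf_lt1.
Qed.

Lemma kernel_primitiveE n j :
  fracint_kernel alpha (q ^ n) (q ^ j) = (fracint_const p alpha)^-1 * (L n - L j).
Proof.
rewrite /kernel_primitive -mulrBr mulKf ?fracint_const_neq0//.
by rewrite /fracint_kernel; case: ifP.
Qed.

(** For [alpha <> 1] the increment of [(a/q)^j] is [(a/q)^j (a/q - 1)], for
    [alpha = 1] that of [ln (q^j)] is [ln q]; the constant cancels [a/q - 1]
    and [ln q] respectively. *)
Lemma kernel_primitive_step j : L (j + 1) = L j - (1 - a^-1) * (a / q) ^ j.
Proof.
rewrite /kernel_primitive fracint_constE; case: ifPn => [/eqP a1|a1].
  have aq : a = q by rewrite /a a1 powRr1// ltW.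
  rewrite aq mulfV// exp1rz exprz_addn1// lnM ?posrE ?exprz_gt0//.
  by field; rewrite q_neq0 lnq_neq0.
rewrite !powR_exprz ?ltW// powR_sub1 exprz_addn1 ?mulf_neq0 ?invr_neq0//.
move: ((a / q) ^ j) => aqj; have := aq_neq1 a1.
rewrite -{1}(mulfV q_neq0) -mulrBl mulf_eq0 negb_or => /andP[aq1 _].
field; rewrite a_neq0 q_neq0 //=.
Qed.

(** In the ball of radius [q^n], off the balls of radius [q^(n-1)] around [0]
    and [t], all of [|y|],
    [|t - y|] and [|t|] equal [q^n] and the kernel vanishes.  Near [0] one has
    [|t - y| = q^n], near [t] one has [|y| = q^n], so that on the second ball
    the kernel changes sign and the density is constant. *)
Lemma fracint_radial (psi : R -> R) n t : nm t = q ^ n ->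
  abscvg (descending (n - 1) (fun j => (L n - L j) * (q ^ j * psi (q ^ j)))) ->
  abscvg (descending (n - 1) (fun j => (L n - L j) * q ^ j)) ->
  fracint mu alpha (fun y => psi (nm y)) t = (1 - q^-1) *
    (sum_lt n (fun j => (L n - L j) * (q ^ j * psi (q ^ j))) -
     psi (q ^ n) * sum_lt n (fun j => (L n - L j) * q ^ j)).
Proof.
move=> tn cA cB; set C := fracint_const p alpha.
have C0 : C != 0 by exact: fracint_const_neq0.
have t0 : t != 0.
  by rewrite -(padic_norm_eq0 R) tn expfz_neq0.
rewrite /fracint (negPf t0) tn -/C.
set h := fracint_integrand alpha _ t.
have EA : (fun j => q ^ j * (fracint_kernel alpha (q ^ n) (q ^ j) * psi (q ^ j))) =
    (fun j => C^-1 * ((L n - L j) * (q ^ j * psi (q ^ j)))).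
  by apply/funext => j; rewrite kernel_primitiveE -/C; ring.
have EB : (fun j => q ^ j * (fracint_kernel alpha (q ^ j) (q ^ n) * psi (q ^ n))) =
    (fun j => (- (C^-1 * psi (q ^ n))) * ((L n - L j) * q ^ j)).
  by apply/funext => j; rewrite kernel_primitiveE -/C; ring.
have [iA IA] : mu.-integrable (pball R 0 (n - 1)) (EFin \o h) /\
    \int[mu]_(y in pball R 0 (n - 1)) h y = (1 - q^-1) *
    (C^-1 * sum_lt n (fun j => (L n - L j) * (q ^ j * psi (q ^ j)))).
  rewrite -(sum_ltZ _ cA) -EA.
  apply: (pball_integral mu_haar) => [y j|].
    rewrite subr0 /h /fracint_integrand => yj jn; rewrite padic_norm_sub_lt ?yj ?tn//.
    by rewrite ltr_eXz2l// -lez_subr1.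
  by rewrite EA; exact: abscvg_descendingZ.
have [iB IB] : mu.-integrable (pball R t (n - 1)) (EFin \o h) /\
    \int[mu]_(y in pball R t (n - 1)) h y = (1 - q^-1) *
    (- (C^-1 * psi (q ^ n)) * sum_lt n (fun j => (L n - L j) * q ^ j)).
  rewrite -(sum_ltZ _ cB) -EB.
  apply: (pball_integral mu_haar) => [y j yj jn|].
    rewrite /h /fracint_integrand padic_normB yj (padic_norm_near tn)//.
    by rewrite /pball /= yj ler_eXz2l.
  by rewrite EB; exact: abscvg_descendingZ.
have DE : [set y | nm y <= q ^ n] = pball R (0 : Qp) n.
  by apply/seteqP; split => y; rewrite /pball /= subr0.
rewrite DE.
have [|||||||_ ->] := @integral_two_pieces _ _ _ mu _ _ (pball R 0 n) h _ _ _ _ _ _ _ iA iB.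
- exact: measurable_pball.
- exact: measurable_pball.
- exact: measurable_pball.
- apply/disj_setPS => y [yA yB]; have := padic_norm_near tn yB.
  move: yA; rewrite /pball /= subr0 => /[swap] ->; by rewrite ler_eXz2l// lez_subr1 ltxx.
- by move=> y; rewrite /pball /= => /le_trans; apply; rewrite ler_eXz2l// gerBl.
- by move=> y yB; rewrite /pball /= subr0 (padic_norm_near tn yB).
- move=> y yn yA yB.
  rewrite /h /fracint_integrand (padic_normB R t y).
  rewrite (padic_norm_shell _ yB) -1?{1}[y]subr0 ?(padic_norm_shell yn yA).
    by rewrite /fracint_kernel; case: ifP => _; rewrite subrr mul0r.
  move: yn; rewrite /pball /= subr0 => yn.
  by rewrite (le_trans (padic_normD _ _ _))// padic_normN tn ge_max yn lexx.
- rewrite IA IB; by field; rewrite ?(q_neq0, C0).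
Qed.

(** For [|y| <= q^n] with [y] outside the ball of radius [q^(n-1)] around [t] the
    difference vanishes since [|t - y| = |t|].  For [|y| > q^n] one has
    [|t - y| = |y|], and the measure of spheres turns [|y|^(-alpha-1)] into
    [a^-j]. *)
Lemma vladimirov_radial (w : R -> R) n t : nm t = q ^ n ->
  abscvg (descending (n - 1) (fun j => q ^ j * (w (q ^ j) - w (q ^ n)))) ->
  abscvg (ascending (n + 1) (fun j => a ^ (- j) * (w (q ^ j) - w (q ^ n)))) ->
  vladimirov_exists mu alpha (fun y => w (nm y)) t /\
  vladimirov mu alpha (fun y => w (nm y)) t =
    (1 - a) / (1 - (a * q)^-1) * ((1 - q^-1) *
    (limn (series (ascending (n + 1) (fun j => a ^ (- j) * (w (q ^ j) - w (q ^ n)))))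
     + (a * q) ^ (- n) * sum_lt n (fun j => q ^ j * (w (q ^ j) - w (q ^ n))))).
Proof.
move=> tn cA cB.
have powE : q `^ (- alpha - 1) = (a * q)^-1.
  by rewrite powRB ?q_neq0 ?implybT// powRN powRr1 ?ltW// invfM.
rewrite /vladimirov_exists /vladimirov powE; set h := vladimirov_integrand alpha _ t.
have hE j : (q ^ j) `^ (- alpha - 1) = (a * q) ^ (- j).
  by rewrite powR_exprz ?ltW// powE exprz_inv.
have EA : (fun j => q ^ j * ((a * q) ^ (- n) * (w (q ^ j) - w (q ^ n)))) =
   (fun j => (a * q) ^ (- n) * (q ^ j * (w (q ^ j) - w (q ^ n)))).
  by apply/funext => j; rewrite mulrCA.
have EB : (fun j => q ^ j * ((a * q) ^ (- j) * (w (q ^ j) - w (q ^ n)))) =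
   (fun j => a ^ (- j) * (w (q ^ j) - w (q ^ n))).
  apply/funext => j; rewrite -!invr_expz exprzMl ?unitfE//.
  have := @expfz_neq0 _ q j q_neq0; have := @expfz_neq0 _ a j a_neq0.
  move: (q ^ j) (a ^ j) => qj aj aj0 qj0.
  by field; rewrite aj0 qj0.
have [iA IA] : mu.-integrable (pball R t (n - 1)) (EFin \o h) /\
    \int[mu]_(y in pball R t (n - 1)) h y = (1 - q^-1) *
    ((a * q) ^ (- n) * sum_lt n (fun j => q ^ j * (w (q ^ j) - w (q ^ n)))).
  rewrite -(sum_ltZ _ cA) -EA.
  apply: (pball_integral mu_haar) => [y j yj jn|].
    rewrite /h /vladimirov_integrand (padic_normB R t y) yj tn (padic_norm_near tn) ?hE//.
    by rewrite /pball /= yj ler_eXz2l.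
  by rewrite EA; exact: abscvg_descendingZ.
have [iB IB] : mu.-integrable [set y | q ^ n < nm y] (EFin \o h) /\
    \int[mu]_(y in [set y | q ^ n < nm y]) h y = (1 - q^-1) *
    limn (series (ascending (n + 1) (fun j => a ^ (- j) * (w (q ^ j) - w (q ^ n))))).
  rewrite -EB.
  apply: (padic_outer_integral mu_haar) => [y j yj nj|].
    rewrite /h /vladimirov_integrand padic_normB padic_norm_sub_lt ?yj ?tn ?hE//.
    by rewrite ltr_eXz2l.
  by rewrite EB.
have [|||||||ih ->] := @integral_two_pieces _ _ _ mu _ _ setT h _ _ _ _ _ _ _ iA iB.
- exact: measurable_pball.
- by rewrite padic_outer_pieces; apply: bigcupT_measurable => k; exact: measurable_psphere.
- exact: measurableT.
- by apply/disj_setPS => y [yA] /=; rewrite (padic_norm_near tn yA) ltxx.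
- by [].
- by [].
- move=> y _ /= yA /negP; rewrite -leNgt => yn.
  rewrite /h /vladimirov_integrand (_ : nm (t - y) = q ^ n) ?tn ?subrr ?mulr0//.
  rewrite padic_normB (padic_norm_shell _ yA)//.
  by rewrite /pball /= (le_trans (padic_normD _ _ _))// padic_normN tn ge_max yn lexx.
- by split => //; rewrite IA IB -/a; ring.
Qed.

(** The general form of the theorem: the right inverse property
    [D^alpha (u0 + I^alpha psi) = psi] for radial [psi] bounded by a multiple of
    [|y|^-gamma]. *)
Lemma vladimirov_fracint_radial (gamma M u0 : R) (psi w : R -> R) :
  0 < gamma < Num.min 1 alpha ->
  (forall j : int, `|psi (q ^ j)| <= M * (q `^ gamma) ^ (- j)) ->
  (forall t, w (nm t) = u0 + fracint mu alpha (fun y => psi (nm y)) t) ->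
  forall t, t != 0 ->
    vladimirov_exists mu alpha (fun y => w (nm y)) t /\
    vladimirov mu alpha (fun y => w (nm y)) t = psi (nm t).
Proof.
rewrite lt_min => /and3P[gamma0 gamma1 gammaa] psiM solutionE t t0.
set g := q `^ gamma in psiM.
have g1 : 1 < g by rewrite -(powRr0 q) powR_lt_exponent.
have gq : g < q by rewrite -[ltRHS](powRr1 (ltW q_gt0)) powR_lt_exponent.
have ga : g < a by exact: powR_lt_exponent.
have Ls := kernel_primitive_step.
have cphi := abscvg_kernel_phi g1 gq ga psiM Ls.
have ccst := abscvg_kernel_cst g1 gq ga Ls.
have wnE n : w (q ^ n) = u0 + (1 - q^-1) *
    (sum_lt n (fun j => (L n - L j) * (q ^ j * psi (q ^ j))) -
     psi (q ^ n) * sum_lt n (fun j => (L n - L j) * q ^ j)).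
  have sn : nm (p%:R ^ (- n)) = q ^ n by rewrite padic_norm_natX opprK.
  by rewrite -{1}sn solutionE (fracint_radial sn).
have [n tn] := padic_norm_exprz R t0.
have cA := abscvg_lower g1 gq ga psiM Ls wnE.
have cB := abscvg_upper g1 gq ga psiM Ls wnE.
have [ex ->] := vladimirov_radial tn (cA n _) (cB n _).
split=> //; rewrite tn.
exact: (radial_inversion g1 gq ga psiM Ls wnE).
Qed.

End RadialOperators.

Theorem theorem5p1 (R : realType) (p : nat) (p_prime : prime p)
  (mu : {measure set (padic p_prime) -> \bar R}) (mu_haar : normalized_haar mu)
  (alpha gamma u0 : R) (f : R -> R -> R)
  (alpha_gt0 : 0 < alpha) (gamma_gt0 : 0 < gamma)
  (gamma_lt : gamma < Num.min 1 alpha)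
  (M : R) (f_bounded : forall (l : int) (x : R), `|f (p%:R ^ l) x| <= M)
  (F : int -> R)
  (F_bound : forall l : int, 0 < F l < p%:R `^ (- alpha * l%:~R))
  (f_lipschitz : forall (l : int) (x y : R),
    `|f (p%:R ^ l) x - f (p%:R ^ l) y| <= F l * `|x - y|)
  (A beta : R) (A_gt0 : 0 < A) (beta_gt : alpha < beta + gamma)
  (f_decay : forall (l : int) (x : R), 1 <= l ->
    `|f (p%:R ^ l) x| <= A * p%:R `^ (- beta * l%:~R))
  (u : R -> R)
  (u_solution : forall t : padic p_prime,
    solves_integral_eq mu alpha gamma f u0 u t)
  (u_iteration : obtained_by_iteration mu alpha gamma f u0 u) :
  forall t : padic p_prime, t != 0 ->
    vladimirov_exists mu alpha (fun s => u (padic_norm R s)) t /\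
    padic_norm R t `^ gamma * vladimirov mu alpha (fun s => u (padic_norm R s)) t
      = f (padic_norm R t) (u (padic_norm R t)).
Proof.
move=> t t0; have q_gt0 : 0 < p%:R :> R by rewrite ltr0n prime_gt0.
have [|||ex ->] := @vladimirov_fracint_radial R p p_prime mu mu_haar alpha alpha_gt0
  gamma M u0 (fun r => ftilde gamma f r (u r)) u _ _ _ t t0.
- by rewrite gamma_gt0.
- move=> j; rewrite /ftilde normrM ger0_norm ?powR_ge0// mulrC powR_exprz ?ler0n//.
  by rewrite powRN exprz_inv ler_wpM2r// exprz_ge0// powR_ge0.
- by move=> s; have [] := u_solution s.
- split => //; rewrite /ftilde powRN mulVKf// gt_eqF// powR_gt0//.
  by rewrite lt_def padic_norm_eq0 t0 padic_norm_ge0.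
Qed.
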